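(* Let $\mathfrak{g}$ be a finite-dimensional complex semisimple Lie algebra with Cartan subalgebra $\mathfrak{h}$ and root system $\Phi$. Let $T$ be a closed subset of $\Phi$, and let $\mathfrak{t}$ be a subalgebra of $\mathfrak{h}$ containing $[\mathfrak{g}_\alpha,\mathfrak{g}_{-\alpha}]$ for each $\alpha\in T^r$. Then the regular subalgebra $\mathfrak{s}_{T,\mathfrak{t}}$ is wide if and only if $[T\cup -T]=\Phi$.
   Context: All Lie algebras and modules are finite-dimensional over $\mathbb{C}$. $\mathfrak{g}_\alpha$ is the root space of $\alpha\in\Phi$. A subset $T\subseteq\Phi$ is closed if $x,y\in T$ and $x+y\in\Phi$ imply $x+y\in T$. For closed $T$, $T^r=\{\alpha\in T\mid -\alpha\in T\}$. For $S\subseteq\Phi$, $[S]$ is the smallest closed subset of $\Phi$ containing $S$; $-T=\{-\alpha\mid\alpha\in T\}$. $\mathfrak{s}_{T,\mathfrak{t}} := \mathfrak{t}\oplus\bigoplus_{\alpha\in T}\mathfrak{g}_\alpha$, a subalgebra of $\mathfrak{g}$. A subalgebra $\mathfrak{s}\subseteq\mathfrak{g}$ is wide if every simple $\mathfrak{g}$-module is indecomposable as an $\mathfrak{s}$-module (i.e. is not a direct sum of two nonzero $\mathfrak{s}$-submodules). *)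

(* Defs.v *)
From HB Require Import structures.
From mathcomp Require Import all_boot all_order all_algebra.
From mathcomp Require Import finmap.
From mathcomp Require Import mathcomp_extra boolp classical_sets functions.
From mathcomp Require Import cardinality fsbigop reals.
From mathcomp Require Export complex.

Set Implicit Arguments.
Unset Strict Implicit.
Unset Printing Implicit Defensive.

Import Order.TTheory GRing.Theory Num.Theory.
Local Open Scope classical_set_scope.
Local Open Scope ring_scope.

HB.mixin Record Vector_isLieAlgebra (F : fieldType) g of Vector F g := {
  bracket : g -> g -> g;
  bracket_is_linear : forall x, linear (bracket x);
  bracketl_is_linear : forall y, linear (bracket^~ y);
  bracketxx : forall x, bracket x x = 0;
  bracket_jacobi : forall x y z,
    bracket x (bracket y z) + bracket y (bracket z x)
      + bracket z (bracket x y) = 0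
}.

#[short(type="lieAlgType")]
HB.structure Definition LieAlgebra (F : fieldType) :=
  { g of Vector F g & Vector_isLieAlgebra F g }.

Section LieAlgebraTheory.
Variables (F : fieldType) (g : lieAlgType F).
Implicit Types (x y z : g) (U V W I h s t : {vspace g}).

HB.instance Definition _ x :=
  GRing.isLinear.Build F g g *:%R (bracket x) (bracket_is_linear x).

Definition bracketr y x : g := bracket x y.

HB.instance Definition _ y :=
  GRing.isLinear.Build F g g *:%R (bracketr y) (bracketl_is_linear y).

Lemma bracketDl x y z : bracket (x + y) z = bracket x z + bracket y z.
Proof. exact: (linearD (bracketr z)). Qed.

Lemma bracketZl k x z : bracket (k *: x) z = k *: bracket x z.
Proof. exact: (linearZ_LR (bracketr z)). Qed.

Lemma bracket_suml (J : Type) (r : seq J) (P : pred J) (f : J -> g) z :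
  bracket (\sum_(i <- r | P i) f i) z = \sum_(i <- r | P i) bracket (f i) z.
Proof. exact: (linear_sum (bracketr z)). Qed.

Lemma bracketC x y : bracket x y = - bracket y x.
Proof.
have := bracketxx (x + y); rewrite linearD /= !bracketDl.
rewrite !bracketxx add0r addr0 => /eqP.
by rewrite addr_eq0 => /eqP ->; rewrite opprK.
Qed.

Lemma bracketA x y z :
  bracket x (bracket y z) = bracket (bracket x y) z + bracket y (bracket x z).
Proof.
have /eqP := bracket_jacobi x y z; rewrite -addrA addr_eq0 => /eqP ->.
rewrite opprD addrC; congr (_ + _); first by rewrite -bracketC.
by rewrite (bracketC z x) linearN opprK.
Qed.

Definition ad x : 'End(g) := linfun (bracket x).

Definition lie_prod U V : {vspace g} :=
  <<[seq bracket u v | u <- vbasis U, v <- vbasis V]>>%VS.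

Lemma memv_lie_prod U V u v :
  u \in U -> v \in V -> bracket u v \in lie_prod U V.
Proof.
move=> /coord_vbasis -> /coord_vbasis ->.
rewrite bracket_suml memv_suml // => i _.
rewrite bracketZl memvZ // linear_sum memv_suml // => j _.
rewrite linearZ memvZ // memv_span //.
by apply: allpairs_f; rewrite mem_nth ?size_tuple.
Qed.

Lemma lie_prod_subP U V W :
  (lie_prod U V <= W)%VS <->
  {in U & V, forall u v, bracket u v \in W}.
Proof.
split=> [/subvP sub u v uU vV|sub]; first exact/sub/memv_lie_prod.
apply/span_subvP => _ /allpairsP[[u v] [/= uU vV ->]].
by apply: sub; exact: vbasis_mem.
Qed.

Definition lie_subalg s := {in s &, forall x y, bracket x y \in s}.

Definition lie_ideal I := forall x, {in I, forall y, bracket x y \in I}.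

Definition derived_series I n := iter n (fun U => lie_prod U U) I.

Definition lie_solvable I := exists n, derived_series I n = 0%VS.

Definition lower_central_series s n := iter n (lie_prod s) s.

Definition lie_nilpotent s := exists n, lower_central_series s n = 0%VS.

Definition lie_semisimple :=
  forall I, lie_ideal I -> lie_solvable I -> I = 0%VS.

Definition self_normalizing s :=
  forall x, {in s, forall y, bracket x y \in s} -> x \in s.

Definition cartan_subalg h :=
  [/\ lie_subalg h, lie_nilpotent h & self_normalizing h].

Section Roots.
Variable h : {vspace g}.

Definition dualv := 'Hom(subvs_of h, F^o).
Implicit Types (a b : dualv) (S T : set dualv).

Definition root_space a : {vspace g} :=
  (\bigcap_(x <- vbasis {: subvs_of h})
     lker (ad (vsval x) - (a x : F) *: \1%VF))%VS.

Lemma root_spaceP a y :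
  reflect (forall x : subvs_of h, bracket (vsval x) y = (a x : F) *: y)
          (y \in root_space a).
Proof.
have kerE (x : subvs_of h) :
    (y \in lker (ad (vsval x) - (a x : F) *: \1%VF))%R
    = (bracket (vsval x) y == (a x : F) *: y).
  by rewrite memv_ker add_lfunE opp_lfunE scale_lfunE id_lfunE lfunE /= subr_eq0.
have bigcapP (X : seq (subvs_of h)) :
    reflect {in X, forall x : subvs_of h, bracket (vsval x) y = (a x : F) *: y}
      (y \in (\bigcap_(x <- X) lker (ad (vsval x) - (a x : F) *: \1%VF))%VS).
  elim: X => [|x X IH]; first by rewrite big_nil memvf; constructor.
  rewrite big_cons memv_cap kerE.
  apply: (iffP andP) => [[/eqP e /IH f] z|f].
    by rewrite inE => /orP[/eqP ->|/f].
  split; first by apply/eqP/f; rewrite mem_head.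
  by apply/IH => z zX; apply: f; rewrite inE zX orbT.
apply: (iffP (bigcapP _)) => [f x|f x _]; last exact: f.
rewrite (coord_vbasis (memvf x)) !linear_sum /= bracket_suml.
rewrite scaler_suml; apply: eq_bigr => i _.
rewrite !linearZ /= bracketZl f ?mem_nth ?size_tuple //.
by rewrite scalerA.
Qed.

Lemma bracket_root_space a b x y :
  x \in root_space a -> y \in root_space b -> bracket x y \in root_space (a + b).
Proof.
move=> /root_spaceP ex /root_spaceP ey; apply/root_spaceP => z.
rewrite bracketA ex ey linearZ bracketZl /=.
by rewrite add_lfunE scalerDl.
Qed.

Definition root_system : set dualv := [set a | a <> 0 /\ root_space a <> 0%VS].

Lemma root_space_indep (s : seq dualv) (v : dualv -> g) : uniq s ->
  {in s, forall a, v a \in root_space a} ->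
  \sum_(a <- s) v a = 0 -> {in s, forall a, v a = 0}.
Proof.
elim: s v => [//|a s IH] v /= /andP[aNs us] vE sum0.
have vs0 : {in s, forall b, v b = 0}.
  move=> b bs; apply/eqP/negP => vb0.
  have /negP[] : a != b by apply: contraNneq aNs => ->.
  apply/eqP/lfunP => x.
  have := IH (fun c => (c x - a x : F) *: v c) us.
  have h1 : {in s, forall c : dualv, (c x - a x : F) *: v c \in root_space c}.
    by move=> c cs; rewrite memvZ // vE // inE cs orbT.
  have h2 : \sum_(c <- s) ((c : dualv) x - a x : F) *: v c = 0.
    have e0 : bracket (vsval x) (\sum_(c <- a :: s) v c)
              - (a x : F) *: (\sum_(c <- a :: s) v c) = 0.
      by rewrite sum0 linear0 scaler0 subrr.
    rewrite -[RHS]e0 linear_sum scaler_sumr -sumrB big_cons /=.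
    have /root_spaceP -> := vE a (mem_head _ _).
    rewrite subrr add0r; apply: eq_big_seq => c cs.
    have /root_spaceP -> : v c \in root_space c by rewrite vE // inE cs orbT.
    by rewrite scalerBl.
  move=> /(_ h1 h2 b bs) /eqP; rewrite scaler_eq0 subr_eq0.
  by case/orP => [/eqP -> //|/vb0].
move=> b; rewrite inE => /orP[/eqP ->|/vs0 //].
by move: sum0; rewrite big_cons big_seq big1 ?addr0.
Qed.

Lemma finite_roots : finite_set root_system.
Proof.
apply: contrapT => /(infinite_set_fset (\dim {:g}).+1) [B Broots].
apply/negP; rewrite -ltnNge ltnS.
pose v a := vpick (root_space a).
have vB a : a \in B -> v a != 0.
  by move=> /Broots [_ /eqP]; rewrite vpick0.
suff fr : free [seq v a | a <- enum_fset B].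
  by rewrite -(size_map v) -(eqP fr) dimvS ?subvf.
have -> : [seq v a | a <- enum_fset B] = map_tuple v (in_tuple (enum_fset B)).
  by [].
apply/freeP => k sum0 i.
pose B' := enum_fset B.
have uB : uniq B' by exact: fset_uniq.
pose w a := (if insub (index a B') is Some j then k j else 0) *: v a.
have iE (j : 'I_(size B')) : w B'`_j = k j *: v B'`_j.
  rewrite /w index_uniq //; case: insubP => [u _ uE|/negP[] //].
  by congr (k _ *: _); apply: val_inj.
have : w B'`_i = 0.
  apply: (@root_space_indep B' w) => //; last by rewrite mem_nth.
    by move=> a _; rewrite memvZ // memv_pick.
  rewrite (big_nth 0) big_mkord -[RHS]sum0; apply: eq_bigr => j _.
  by rewrite iE; congr (_ *: _); rewrite (nth_map 0).
rewrite iE => /eqP; rewrite scaler_eq0 => /orP[/eqP //|].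
by rewrite (negPf (vB _ _)) // mem_nth.
Qed.

Definition opp_roots T : set dualv := [set - a | a in T].

Definition closed_roots T :=
  T `<=` root_system /\
  forall a b, T a -> T b -> root_system (a + b) -> T (a + b).

Definition symm_part T : set dualv := [set a | T a /\ T (- a)].

(* [S], the intersection of the closed subsets of the root system containing S. *)
Definition closed_hull S : set dualv := smallest closed_roots S.

Lemma closed_roots_roots : closed_roots root_system.
Proof. by split. Qed.

Lemma closed_roots_hull S : S `<=` root_system -> closed_roots (closed_hull S).
Proof.
move=> Sr; split=> [a /(_ _ (conj closed_roots_roots Sr)) //|].
move=> a b ha hb hab U [cU SU].
by apply: cU.2 => //; [exact: ha | exact: hb].
Qed.

(* The big sum over a set is meaningful because root_system is finite, see
   finite_roots and regular_subP. *)
Definition regular_subalg T t : {vspace g} :=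
  (t + \big[addv/0]_(a \in T) root_space a)%VS.

Lemma sub_root_regular T t a :
  T `<=` root_system -> T a -> (root_space a <= regular_subalg T t)%VS.
Proof.
move=> Tr Ta; apply: subv_trans (addvSr _ _).
have finT : finite_set T by exact: sub_finite_set finite_roots.
by rewrite fsbig_finite //= (big_fsetD1 a) ?in_fset_set ?inE //= addvSl.
Qed.

Lemma regular_subP T t W : T `<=` root_system ->
  (regular_subalg T t <= W)%VS <->
  (t <= W)%VS /\ forall a, T a -> (root_space a <= W)%VS.
Proof.
move=> Tr; split=> [sW|[tW TW]].
  split; first exact: subv_trans (addvSl _ _) sW.
  by move=> a Ta; exact: subv_trans (sub_root_regular _ Tr Ta) sW.
rewrite subv_add tW /= fsbig_finite; last exact: sub_finite_set finite_roots.
rewrite big_seq; elim/big_ind: _ => [|U V UW VW|a]; rewrite ?sub0v ?subv_add ?UW //.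
rewrite in_fset_set ?inE; last exact: sub_finite_set finite_roots.
exact: TW.
Qed.

Lemma lie_subalg_regular T t : closed_roots T ->
    (t <= h)%VS -> lie_subalg t ->
    (forall a, symm_part T a ->
       (lie_prod (root_space a) (root_space (- a)) <= t)%VS) ->
  lie_subalg (regular_subalg T t).
Proof.
move=> [Tr Tcl] th tt tT; set s := regular_subalg T t.
have ts : (t <= s)%VS by exact: addvSl.
have tbr x a : x \in t -> T a ->
    {in root_space a, forall y, bracket x y \in s}.
  move=> /(subvP th) xh Ta y ya.
  have /root_spaceP/(_ (Subvs xh)) -> := ya.
  by rewrite memvZ //; exact: subvP (sub_root_regular t Tr Ta) _ ya.
have rr a b : T a -> T b ->
    {in root_space a & root_space b, forall x y, bracket x y \in s}.
  move=> Ta Tb x y xa yb; have xy := bracket_root_space xa yb.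
  have [/eqP|ab0] := eqVneq (a + b) 0.
    rewrite addr_eq0 eq_sym eqr_oppLR => /eqP bE; rewrite bE in Tb yb.
    apply: subvP ts _ _; apply: subvP (tT a (conj Ta Tb)) _ _.
    exact: memv_lie_prod.
  have [z|abr] := eqVneq (root_space (a + b)) 0%VS.
    by move: xy; rewrite z memv0 => /eqP ->; rewrite mem0v.
  have Tab : T (a + b) by apply: Tcl => //; split; apply/eqP.
  exact: subvP (sub_root_regular t Tr Tab) _ xy.
suff hs : {in s, forall x, (s <= ad x @^-1: s)%VS}.
  by move=> x y /hs/subvP sub /sub; rewrite -memv_preim lfunE.
pose adr y : 'End(g) := linfun (bracketr y).
have gen y : (forall x, x \in t -> bracket x y \in s) ->
    (forall a x, T a -> x \in root_space a -> bracket x y \in s) ->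
    {in s, forall x, bracket x y \in s}.
  move=> ft fT x xs; suff /subvP/(_ x xs) : (s <= adr y @^-1: s)%VS.
    by rewrite -memv_preim lfunE.
  apply/regular_subP => //; split=> [|a Ta]; apply/subvP => z zs.
    by rewrite -memv_preim lfunE; exact: ft.
  by rewrite -memv_preim lfunE; exact: fT zs.
move=> x xs; apply/regular_subP => //; split=> [|a Ta]; apply/subvP => y ys;
  rewrite -memv_preim lfunE /=; apply: gen xs => [z zt|b z Tb zb].
- by apply: subvP ts _ _; exact: tt.
- by rewrite bracketC memvN; exact: tbr zb.
- exact: tbr ys.
- exact: rr zb ys.
Qed.

End Roots.

Record lieModule := LieModule {
  lmod_carrier :> vectType F;
  lmod_action : 'Hom(g, 'End(lmod_carrier));
  lmod_action_bracket : forall x y v,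
    lmod_action (bracket x y) v
    = lmod_action x (lmod_action y v) - lmod_action y (lmod_action x v)
}.

Implicit Type M : lieModule.

Definition submodule s M (U : {vspace M}) :=
  forall x v, x \in s -> v \in U -> lmod_action M x v \in U.

Definition simple_module M :=
  {: M}%VS <> 0%VS /\
  forall U : {vspace M}, submodule {: g} U -> U = 0%VS \/ U = {: M}%VS.

Definition indecomposable s M :=
  forall A B : {vspace M}, submodule s A -> submodule s B ->
    (A + B)%VS = {: M}%VS -> (A :&: B)%VS = 0%VS -> A = 0%VS \/ B = 0%VS.

Definition wide s := forall M, simple_module M -> indecomposable s M.

End LieAlgebraTheory.

Arguments root_system {F g} h _.

(* Main.v *)
Require Import Defs.
From HB Require Import structures.
From mathcomp Require Import all_boot all_order all_algebra.
From mathcomp Require Import complex boolp classical_sets reals.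
From mathcomp Require Import ring.

Set Implicit Arguments.
Unset Strict Implicit.
Unset Printing Implicit Defensive.

Import Order.TTheory GRing.Theory Num.Theory.

Local Open Scope classical_set_scope.
Local Open Scope ring_scope.

(** Sufficiency. Let M be a simple module, s the regular subalgebra, and P the
    projection of an s-stable decomposition of M. It lies in the algebra A of
    the endomorphisms of M that commute with the root vectors of T. The Cartan
    subalgebra acts on A, and A is graded by weights. An element of A of weight
    0 is, for each a in T, a primitive vector of weight 0 for the sl(2) of a, so
    it also commutes with the root vectors of -T (primitive_weight0). As T and -T
    generate the root system and root vectors generate g (bracket_root_spaces,
    root_generation), it commutes with g, and it is a scalar by Schur's lemma:
    this is centralizer_weight0. Elements of A of nonzero weight have trace 0,
    and a product of two of opposite weights is 0, because it is a scalar while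
    each factor is nilpotent. So, if c is the component of P of weight 0, then
    tr P = c dim M and tr P = tr P^2 = c tr P; hence c is 0 or 1, the rank tr P
    of P is 0 or dim M, and P is trivial (centralizer_idempotent).

    Necessity. Let S be the closed set generated by T and -T, and a a root outside
    S. The adjoint module of g is the sum of k, spanned by the Cartan subalgebra
    and the root spaces of S, and of the span m of the other root spaces. As S is
    closed and symmetric, both are stable under k, which contains s. The simple
    ideal of g containing the root space of a is the sum of its intersections with
    k and m, and neither vanishes, as they contain the coroot of a and the root
    space of a (decomposable_simple_module).

    Both parts rest on the structure of semisimple Lie algebras, obtained here from
    the absence of solvable ideals. A nilpotent subalgebra h decomposes every module
    into generalized weight spaces (gwt_span), and h is its own weight space of
    weight 0 when it is a Cartan subalgebra, by Engel's theorem (grs0). If x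
    and y are generalized root vectors for a and -a, then any weight is a real
    multiple of a on [x, y] (ev_bracket_real), so that the Killing square of [x, y]
    is a sum of nonnegative reals times a([x, y])^2. In an isotropic ideal all the
    weights thus vanish on such brackets, and Engel's theorem shows that the ideal
    is solvable, hence 0: the Killing form is nondegenerate (killing_isotropic_ideal).
    The usual description of root spaces and of their sl(2) triples follows.
    Operators are restricted to weight spaces by composing them with projections,
    and all multiplicities are traces of projections. *)

(** * Subspaces and linear maps given by predicates and functions *)

Section Subspaces.
Variables (K : fieldType) (V : vectType K).

Lemma vspace_max (Q : {vspace V} -> Prop) U0 : Q U0 ->
  exists2 U, Q U & forall U', Q U' -> (\dim U' <= \dim U)%N.
Proof.
move=> QU0; pose P n := `[< exists2 U, Q U & \dim U = n >].
have exP : exists n, P n by exists (\dim U0); apply/asboolP; exists U0.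
have ubP n : P n -> (n <= \dim {:V})%N.
  by move=> /asboolP[U _ <-]; apply/dimvS/subvf.
case: (ex_maxnP exP ubP) => n /asboolP[U QU <-] maxU.
by exists U => // U' QU'; apply: maxU; apply/asboolP; exists U'.
Qed.

Lemma vspace_min (Q : {vspace V} -> Prop) U0 : Q U0 ->
  exists2 U, Q U & forall U', Q U' -> (\dim U <= \dim U')%N.
Proof.
move=> QU0; pose P n := `[< exists2 U, Q U & \dim U = n >].
have exP : exists n, P n by exists (\dim U0); apply/asboolP; exists U0.
case: (ex_minnP exP) => n /asboolP[U QU <-] minU.
by exists U => // U' QU'; apply: minU; apply/asboolP; exists U'.
Qed.

Definition lin_closed (P : V -> Prop) :=
  P 0 /\ forall k u v, P u -> P v -> P (k *: u + v).

(** A subspace of maximal dimension among those contained in P is all of P. *)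
Lemma lin_closed_vspace P : lin_closed P ->
  exists U : {vspace V}, forall v, v \in U <-> P v.
Proof.
move=> [P0 Pl]; pose Q (U : {vspace V}) := {in U, forall v, P v}.
have [|U QU maxU] := @vspace_max Q 0%VS.
  by move=> v; rewrite memv0 => /eqP ->.
exists U => v; split=> [/QU //|Pv].
have QUv : Q (U + <[v]>)%VS.
  move=> _ /memv_addP[u /QU Pu [w /vlineP[k ->] ->]].
  by rewrite addrC; exact: Pl.
have /eqP -> : U == (U + <[v]>)%VS by rewrite eqEdim addvSl maxU.
by rewrite (subvP (addvSr _ _)) ?memv_line.
Qed.

Definition pred_vspace (P : V -> Prop) : {vspace V} :=
  if pselect (exists U : {vspace V}, forall v, v \in U <-> P v) is left e
  then projT1 (cid e) else 0%VS.

Lemma pred_vspaceP P v : lin_closed P -> reflect (P v) (v \in pred_vspace P).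
Proof.
move=> lP; have e := lin_closed_vspace lP.
rewrite /pred_vspace; case: pselect => // e'; case: (cid e') => U /= UP.
by apply: (iffP idP) => /UP.
Qed.

End Subspaces.

Lemma linear_lfun (K : fieldType) (V W : vectType K) (f : V -> W) :
  linear f -> exists F : 'Hom(V, W), forall v, F v = f v.
Proof.
move=> lf; pose m := GRing.isLinear.Build _ _ _ _ f lf.
pose F : {linear V -> W} := HB.pack f m.
by exists (linfun F) => v; rewrite lfunE.
Qed.

(** * Trace *)

Import VectorInternalTheory.

Section Trace.
Variables (F : fieldType).

(** Let A = B D be a full rank factorization. Then D B is nilpotent and has the same
    trace as A, and it is smaller unless A is invertible. *)
Lemma mxtrace_nilpotent n (A : 'M[F]_n) k :
  iter k (mulmx A) 1%:M = 0 -> \tr A = 0.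
Proof.
have [m] := ubnP n; elim: m => // m IH in n k A *; rewrite ltnS => le_nm Ak0.
have [rA|rA] := eqVneq (\rank A) n.
  have uA : A \in unitmx by rewrite -row_free_unit /row_free rA.
  have : iter k (mulmx A) 1%:M \in unitmx.
    elim: k {Ak0} => [|k IHk] /=; first by rewrite unitmx1.
    by rewrite unitmx_mul uA.
  rewrite Ak0 unitmxE.
  case: n A {le_nm rA uA Ak0} => [|n] A; first by rewrite /mxtrace big_ord0.
  by rewrite det0 unitr0.
rewrite -{1}(mulmx_base A) mxtrace_mulC.
have := mulmx_base A; move: (col_base A) (row_base A) => B D BD.
apply: (IH _ k.+1).
  by apply: leq_trans le_nm; rewrite ltn_neqAle rA rank_leq_row.
have -> j : iter j.+1 (mulmx (D *m B)) 1%:M = D *m iter j (mulmx A) 1%:M *m B.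
  elim: j => [|j IHj]; first by rewrite /= !mulmx1.
  by rewrite iterS IHj [in RHS]iterS !mulmxA -(mulmxA D B D) BD.
by rewrite Ak0 mulmx0 mul0mx.
Qed.


(** With A = B D of full rank, A A = A means that D B is the identity matrix. *)
Lemma mxtrace_idempotent n (A : 'M[F]_n) : A *m A = A -> \tr A = (\rank A)%:R.
Proof.
move=> AA; rewrite -{1}(mulmx_base A) mxtrace_mulC.
suff -> : row_base A *m col_base A = 1%:M by rewrite mxtrace1.
have fB : row_full (col_base A) by exact: col_base_full.
have fD : row_free (row_base A) by exact: row_base_free.
apply: (row_full_inj fB); apply: (row_free_inj fD).
have := mulmx_base A; move: (col_base A) (row_base A) => B D BD.
by rewrite mulmx1 !mulmxA BD -mulmxA BD.
Qed.

Variable (V : vectType F).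
Implicit Types f g p : 'End(V).

Definition lftrace f : F := \tr (f2mx f).

Lemma v2r_lfun f v : v2r (f v) = v2r v *m f2mx f.
Proof. by rewrite unlock /= r2vK. Qed.

Lemma f2mx_eq f (A : 'M_(dim V)) :
  (forall v, v2r (f v) = v2r v *m A) -> f2mx f = A.
Proof.
move=> fA; apply/row_matrixP => i; rewrite !rowE.
by rewrite -[delta_mx _ _](@r2vK _ V) -v2r_lfun fA.
Qed.

Lemma f2mx_comp f g : f2mx (f \o g)%VF = f2mx g *m f2mx f.
Proof. by apply: f2mx_eq => v; rewrite comp_lfunE !v2r_lfun mulmxA. Qed.

Lemma f2mx1 : f2mx (\1%VF : 'End(V)) = 1%:M.
Proof. by apply: f2mx_eq => v; rewrite id_lfunE mulmx1. Qed.

Lemma f2mx_iter f k : f2mx (iter k (comp_lfun f) \1%VF) = iter k (mulmx (f2mx f)) 1%:M.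
Proof.
elim: k => [|k IHk]; first exact: f2mx1.
rewrite iterS f2mx_comp IHk [RHS]iterS; elim: k {IHk} => [|k IHk] /=.
  by rewrite mulmx1 mul1mx.
by rewrite -mulmxA IHk.
Qed.

Lemma lftrace_is_linear : linear (lftrace : _ -> F^o).
Proof.
move=> k f g; rewrite /lftrace -linearZ -linearD; congr (\tr _).
apply: f2mx_eq => v; rewrite add_lfunE scale_lfunE linearD linearZ /=.
by rewrite !v2r_lfun mulmxDr -scalemxAr.
Qed.
HB.instance Definition _ :=
  GRing.isLinear.Build F 'End(V) F^o *:%R lftrace lftrace_is_linear.

Lemma lftraceC f g : lftrace (f \o g)%VF = lftrace (g \o f)%VF.
Proof. by rewrite /lftrace !f2mx_comp mxtrace_mulC. Qed.

Lemma lftraceZ k f : lftrace (k *: f) = k * lftrace f.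
Proof. exact: linearZ. Qed.

Lemma lftraceB f g : lftrace (f - g) = lftrace f - lftrace g.
Proof. exact: linearB. Qed.

Lemma lftraceD f g : lftrace (f + g) = lftrace f + lftrace g.
Proof. exact: linearD. Qed.

Lemma lftrace_sum (I : Type) (r : seq I) (P : pred I) (f : I -> 'End(V)) :
  lftrace (\sum_(i <- r | P i) f i) = \sum_(i <- r | P i) lftrace (f i).
Proof. exact: linear_sum. Qed.

Lemma lftrace1 : lftrace \1%VF = (\dim {:V})%:R.
Proof. by rewrite /lftrace f2mx1 mxtrace1 dimvf. Qed.

Lemma lftrace_nilpotent f k : (forall v, iter k f v = 0) -> lftrace f = 0.
Proof.
move=> fk0; apply: (@mxtrace_nilpotent _ _ k); rewrite -f2mx_iter.
apply: f2mx_eq => v; rewrite mulmx0; suff -> : iter k (comp_lfun f) \1%VF v = 0.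
  by rewrite linear0.
by rewrite -[RHS](fk0 v); elim: k {fk0} => [|k IHk] /=; rewrite ?id_lfunE ?comp_lfunE ?IHk.
Qed.

Lemma lftrace_idempotent p : (p \o p)%VF = p ->
  exists2 n : nat, lftrace p = n%:R & (n == 0) = (p == 0).
Proof.
move=> pp; exists (\rank (f2mx p)).
  by apply: mxtrace_idempotent; rewrite -f2mx_comp pp.
rewrite mxrank_eq0; apply/eqP/eqP => [p0|->].
  by apply/lfunP => v; apply: v2r_inj; rewrite v2r_lfun p0 mulmx0 lfunE /= linear0.
by apply: f2mx_eq => v; rewrite lfunE /= linear0 mulmx0.
Qed.

End Trace.

(** * Generalized eigenvectors *)

Section GenEigen.
Variables (F : fieldType).
Implicit Types (V : vectType F) (c d : F).

Definition subscalar V (f : 'End(V)) c : 'End(V) := (f - c *: \1)%VF.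

Lemma subscalarE V (f : 'End(V)) c v : subscalar f c v = f v - c *: v.
Proof. by rewrite /subscalar add_lfunE opp_lfunE scale_lfunE id_lfunE. Qed.

Definition gen_eigen V (f : 'End(V)) c v := exists n, iter n (subscalar f c) v = 0.

Lemma iter_lfun_lin V (f : 'End(V)) n k u v :
  iter n f (k *: u + v) = k *: iter n f u + iter n f v.
Proof. by elim: n => [//|n IHn] /=; rewrite IHn linearP. Qed.

Lemma iter_lfun0 V (f : 'End(V)) n : iter n f 0 = 0.
Proof. by elim: n => [//|n IHn] /=; rewrite IHn linear0. Qed.

Lemma iter_lfun_leq V (f : 'End(V)) n m v :
  (n <= m)%N -> iter n f v = 0 -> iter m f v = 0.
Proof. by move=> /subnK <- fn0; rewrite iterD fn0 iter_lfun0. Qed.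

Lemma gen_eigen0 V (f : 'End(V)) c : gen_eigen f c 0.
Proof. by exists 0%N. Qed.

Lemma gen_eigen_lin V (f : 'End(V)) c : lin_closed (gen_eigen f c).
Proof.
split=> [|k u v [n un] [m vm]]; first exact: gen_eigen0.
exists (maxn n m); rewrite iter_lfun_lin.
by rewrite (iter_lfun_leq (leq_maxl n m) un) (iter_lfun_leq (leq_maxr n m) vm) scaler0 addr0.
Qed.

Lemma gen_eigen_eigen V (f : 'End(V)) c v : f v = c *: v -> gen_eigen f c v.
Proof. by move=> fv; exists 1%N; rewrite /= subscalarE fv subrr. Qed.

(** In every case below, B is a pairing of modules and the hypothesis on B says that an
    element of the Lie algebra acts by the Leibniz rule. Then f3 - (a + b) sends B u v to
    B ((f1 - a) u) v + B u ((f2 - b) v), and one concludes by induction on the sum of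
    the exponents that kill u and v. *)
Lemma gen_eigen_bilinear V1 V2 V3 (f1 : 'End(V1)) (f2 : 'End(V2)) (f3 : 'End(V3))
    (B : V1 -> V2 -> V3) :
    (forall v, linear (B^~ v)) -> (forall u, linear (B u)) ->
    (forall u v, f3 (B u v) = B (f1 u) v + B u (f2 v)) ->
  forall a b u v, gen_eigen f1 a u -> gen_eigen f2 b v -> gen_eigen f3 (a + b) (B u v).
Proof.
move=> Bl Br fB a b u v [i ui0] [j vj0]; exists (i + j)%N.
have add0 (x : V3) : x = x + x -> x = 0.
  by move=> /eqP; rewrite -[X in X == _]addr0 (inj_eq (addrI _)) eq_sym => /eqP.
have B0l w : B 0 w = 0.
  by apply: add0; have := Bl w 1 0 0; rewrite !scale1r addr0.
have B0r w : B w 0 = 0.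
  by apply: add0; have := Br w 1 0 0; rewrite !scale1r addr0.
have shB x y : subscalar f3 (a + b) (B x y) = B (subscalar f1 a x) y + B x (subscalar f2 b y).
  have e1 : B (f1 x - a *: x) y = B (f1 x) y - a *: B x y.
    by rewrite addrC -scaleNr Bl addrC scaleNr.
  have e2 : B x (f2 y - b *: y) = B x (f2 y) - b *: B x y.
    by rewrite addrC -scaleNr Br addrC scaleNr.
  by rewrite !subscalarE fB e1 e2 scalerDl opprD addrACA.
have [n le_n] := ubnP (i + j)%N; elim: n => // n IHn in i j u v ui0 vj0 le_n *.
case: i => [|i] in ui0 le_n *.
  by rewrite (ui0 : u = 0) B0l iter_lfun0.
case: j => [|j] in vj0 le_n *.
  by rewrite (vj0 : v = 0) B0r iter_lfun0.
rewrite addnS iterSr shB -[B (subscalar _ _ _) _]scale1r iter_lfun_lin scale1r.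
have h1 : iter (i.+1 + j) (subscalar f3 (a + b)) (B (subscalar f1 a u) v) = 0.
  by rewrite addSnnS; apply: IHn; rewrite -?iterSr.
have h2 : iter (i.+1 + j) (subscalar f3 (a + b)) (B u (subscalar f2 b v)) = 0.
  by apply: IHn; rewrite -?iterSr // -ltnS -addnS.
by rewrite h1 h2 addr0.
Qed.

(** On the generalized eigenvectors for d, f - c is the invertible scalar d - c plus a
    nilpotent operator. *)
Lemma subscalar_surj V (f : 'End(V)) (U : {vspace V}) c d w :
    (forall u, u \in U -> f u \in U) -> c != d -> w \in U -> gen_eigen f d w ->
  exists u, [/\ u \in U, gen_eigen f d u & subscalar f c u = w].
Proof.
move=> fU cd wU [n wn0]; elim: n => [|n IHn] in w wU wn0 *.
  by exists 0; split; rewrite ?mem0v ?linear0 //; exact: gen_eigen0.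
have wU' : subscalar f d w \in U by rewrite subscalarE memvB ?memvZ ?fU.
have [|u [uU ud uw]] := IHn _ wU'; first by rewrite -iterSr.
have dc : d - c != 0 by rewrite subr_eq0 eq_sym.
pose k : F := (d - c)^-1; exists (k *: w - k *: u); split.
- by rewrite memvB ?memvZ.
- rewrite -scalerBr; have := (gen_eigen_lin f d).2 k (w - u) 0.
  rewrite addr0; apply; last exact: gen_eigen0.
  have := (gen_eigen_lin f d).2 (-1) u w ud; rewrite scaleN1r addrC; apply.
  by exists n.+1.
- rewrite -scalerBr linearZ /= linearB /= uw !subscalarE opprB addrC subrKA.
  by rewrite -scalerBl scalerA mulVf // scale1r.
Qed.

Lemma gen_eigen_nilpotent_unif V (f : 'End(V)) c :
  (forall v, gen_eigen f c v) -> exists n, forall v, iter n (subscalar f c) v = 0.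
Proof.
move=> /choice[k fk]; pose b i := (vbasis {:V})`_i.
pose N := (\max_(i < \dim {:V}) k (b i))%N; exists N => v.
have leN i : (k (b (nat_of_ord i)) <= N)%N := leq_bigmax i.
rewrite (coord_vbasis (memvf v)); elim/big_rec: _ => [|i x _ xn].
  exact: iter_lfun0.
rewrite iter_lfun_lin xn addr0 (iter_lfun_leq (leN i)) ?scaler0 //.
Qed.

(** The image of p is stable under f, and (f - c) p is nilpotent. Restrictions of operators
    to subspaces are always replaced with such compositions. *)
Lemma lftrace_gen_eigen V (f p : 'End(V)) c : (p \o p)%VF = p ->
    (forall v, p (f (p v)) = f (p v)) -> (forall v, gen_eigen f c (p v)) ->
  lftrace (f \o p)%VF = c * lftrace p.
Proof.
move=> pp pf fc; have pE v : p (p v) = p v by rewrite -comp_lfunE pp.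
pose N := (subscalar f c \o p)%VF.
have NE n v : iter n.+1 N v = iter n.+1 (subscalar f c) (p v).
  have st m w : p (iter m (subscalar f c) (p w)) = iter m (subscalar f c) (p w).
    elim: m => [|m IHm] /=; first exact: pE.
    by rewrite -IHm subscalarE linearB linearZ /= pf pE.
  elim: n => [|n IHn]; first by rewrite /= comp_lfunE.
  by rewrite iterS IHn comp_lfunE st.
have N0 v : gen_eigen N 0 v.
  have [n fn] := fc v; exists n.+1.
  have -> : subscalar N 0 = N by apply/lfunP => w; rewrite subscalarE scale0r subr0.
  by rewrite NE (iter_lfun_leq (leqnSn n)).
have [n Nn] := gen_eigen_nilpotent_unif N0.
have : lftrace N = 0.
  apply: (@lftrace_nilpotent _ _ _ n) => v; rewrite -[RHS](Nn v).
  by apply: eq_iter => w; rewrite subscalarE scale0r subr0.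
have -> : N = ((f \o p) - c *: p)%VF.
  by apply/lfunP => w; rewrite !comp_lfunE add_lfunE opp_lfunE scale_lfunE comp_lfunE subscalarE.
by rewrite lftraceB lftraceZ => /eqP; rewrite subr_eq0 => /eqP.
Qed.

End GenEigen.

Section GenEigenSpan.
Variable (C : numClosedFieldType).
Let F : fieldType := C.
Implicit Types (V : vectType F) (c d : F).

(** This is the theorem of Cayley and Hamilton, the characteristic polynomial being split. *)
Lemma annihilating_roots V (f : 'End(V)) u :
  exists l : seq F, foldl (fun w c => subscalar f c w) u l = 0.
Proof.
suff [l ul] : exists l : seq F, foldl (fun w c => w *m (f2mx f - c%:M)) (v2r u) l = 0.
  exists l; apply: v2r_inj; rewrite linear0 -ul; elim: l u {ul} => //= c l IHl u.
  by rewrite IHl subscalarE linearB linearZ /= v2r_lfun mulmxBr mul_mx_scalar.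
move: (f2mx f) (v2r u); case: (dim V) => [|n] A w.
  by exists [::]; rewrite /= [w]thinmx0.
have [r pE] := closed_field_poly_normal (char_poly A); exists r.
have := Cayley_Hamilton A; rewrite pE (monicP (char_poly_monic A)) scale1r rmorph_prod.
rewrite (eq_bigr (fun z => A - z%:M)) => [pA0|z _]; last first.
  by rewrite rmorphB /= horner_mx_X horner_mx_C.
rewrite -[RHS](mulmx0 _ w) -pA0; elim: r w {pE pA0} => [|c r IHr] w /=.
  by rewrite big_nil mulmx1.
by rewrite IHr big_cons mulmxA.
Qed.

(** Spanning is expressed by a universal property, which avoids naming the eigenvalues.
    By induction on the list of factors f - c whose product kills u, the vector (f - c) u
    is a sum of generalized eigenvectors. Those for d != c are images under f - c
    of others, by subscalar_surj; after these are subtracted from u, (f - c) u is a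
    generalized eigenvector for c, and so is u. *)
Lemma gen_eigen_span V (f : 'End(V)) (U X : {vspace V}) :
    (forall u, u \in U -> f u \in U) ->
    (forall c u, u \in U -> gen_eigen f c u -> u \in X) ->
  (U <= X)%VS.
Proof.
move=> fU UX; apply/subvP => u uU; have [l] := annihilating_roots f u.
elim: l => [|c l IHl] /= in X u uU UX *; first by move=> ->; rewrite mem0v.
(* P w: w is, up to generalized eigenvectors for c, the image of some x in X *)
pose P w := exists2 x, x \in (X :&: U)%VS & gen_eigen f c (subscalar f c x - w).
have lP : lin_closed P.
  split=> [|k x y [x' x'X xc] [y' y'X yc]].
    by exists 0; rewrite ?mem0v // linear0 subrr; exact: gen_eigen0.
  exists (k *: x' + y'); first by rewrite memvD ?memvZ.
  rewrite linearP opprD addrACA -scalerBr; exact: (gen_eigen_lin f c).2.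
have shU : subscalar f c u \in U by rewrite subscalarE memvB ?memvZ ?fU.
move=> ful0; suff /(IHl (pred_vspace P) _ shU)/(_ ful0)/pred_vspaceP - /(_ lP) [x] :
    forall d w, w \in U -> gen_eigen f d w -> w \in pred_vspace P.
  rewrite memv_cap => /andP[xX xU]; rewrite -linearB => -[n xn].
  rewrite -[u](subKr x); apply: memvB => //.
  by apply: (UX c); [exact: memvB | exists n.+1; rewrite iterSr].
move=> d w wU wd; apply/pred_vspaceP => //.
have [dc|cd] := eqVneq c d.
  exists 0; rewrite ?mem0v // linear0 sub0r.
  rewrite -scaleN1r -[_ *: _]addr0 dc; apply: (gen_eigen_lin f d).2 => //; exact: gen_eigen0.
have [v [vU vd vw]] := subscalar_surj fU cd wU wd.
exists v; first by rewrite memv_cap vU (UX _ _ vU vd).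
by rewrite vw subrr; exact: gen_eigen0.
Qed.

Lemma eigenvector_in V (f : 'End(V)) (U : {vspace V}) :
    (forall u, u \in U -> f u \in U) -> U != 0%VS ->
  exists c v, [/\ v \in U, v != 0 & f v = c *: v].
Proof.
move=> fU U0; apply: contrapT => nev; case/negP: U0; rewrite -subv0.
apply: (gen_eigen_span fU) => c u uU [n]; rewrite memv0.
elim: n => [|n IHn] in u uU *; first by move=> /= ->.
rewrite iterSr => /IHn; rewrite subscalarE memvB ?memvZ ?fU // => /(_ isT).
rewrite subr_eq0 => /eqP fu; apply: contrapT => /negP u0.
by apply: nev; exists c, u.
Qed.

End GenEigenSpan.

Section GenEigenUniq.
Variable (F : fieldType).
Implicit Types (V : vectType F) (c d : F).

Lemma subscalar0 V (f : 'End(V)) : subscalar f 0 = f.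
Proof. by rewrite /subscalar scale0r subr0. Qed.

Lemma gen_eigen_nilp V (f : 'End(V)) n v : iter n f v = 0 -> gen_eigen f 0 v.
Proof. by exists n; rewrite subscalar0. Qed.

Lemma gen_eigen_stable V (f h : 'End(V)) c v :
  (forall u, f (h u) = h (f u)) -> gen_eigen f c v -> gen_eigen f c (h v).
Proof.
move=> fh [n vn]; exists n; have e m : iter m (subscalar f c) (h v) = h (iter m (subscalar f c) v).
  by elim: m => [//|m IHm]; rewrite iterS IHm iterS !subscalarE fh (linearB h) (linearZ_LR h).
by rewrite e vn linear0.
Qed.

Lemma gen_eigen_uniq V (f : 'End(V)) c d v : c != d -> gen_eigen f c v -> gen_eigen f d v -> v = 0.
Proof.
move=> cd [n]; elim: n => [//|n IHn] in v *; rewrite iterSr => vn vd.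
have : subscalar f c v = 0.
  apply: IHn => //; rewrite subscalarE addrC -scaleNr; apply: (gen_eigen_lin f d).2 => //.
  exact: gen_eigen_stable vd.
rewrite subscalarE => /eqP; rewrite subr_eq0 => /eqP fv; have [m] := vd.
have -> : iter m (subscalar f d) v = (c - d) ^+ m *: v.
  elim: m => [|m IHm]; first by rewrite scale1r.
  by rewrite iterS IHm linearZ /= subscalarE fv -scalerBl scalerA exprSr.
by move=> /eqP; rewrite scaler_eq0 expf_eq0 subr_eq0 (negPf cd) andbF => /eqP.
Qed.

End GenEigenUniq.

(** * Weight decompositions *)

Section Adjoint.
Variables (F : fieldType) (g : lieAlgType F).

Lemma ad_is_linear : linear (@ad F g).
Proof.
move=> k x y; apply/lfunP => z.
by rewrite add_lfunE scale_lfunE !lfunE /= bracketDl bracketZl.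
Qed.
HB.instance Definition _ :=
  GRing.isLinear.Build F g 'End(g) *:%R (@ad F g) ad_is_linear.

Lemma adE (x y : g) : ad x y = bracket x y.
Proof. by rewrite lfunE. Qed.

Lemma adjoint_bracket (x y v : g) :
  linfun (@ad F g) (bracket x y) v =
  linfun (@ad F g) x (linfun (@ad F g) y v) - linfun (@ad F g) y (linfun (@ad F g) x v).
Proof.
have e x' y' : linfun (@ad F g) x' y' = bracket x' y' by rewrite lfunE /= adE.
by rewrite !e [bracket x (bracket y v)]bracketA addrK.
Qed.

Definition adjoint : lieModule g := LieModule adjoint_bracket.

Lemma adjointE (x y : g) : lmod_action adjoint x y = bracket x y.
Proof. by rewrite /= lfunE /= adE. Qed.

End Adjoint.
Arguments adjoint {F} g.

Section Weights.
Variable (C : numClosedFieldType).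
Let F : fieldType := C.
Variables (g : lieAlgType F) (h : {vspace g}).
Implicit Types (V : lieModule g) (lam mu a b : dualv h).

(** Generalized weight spaces: h is only known to be nilpotent at first. *)
Definition gwt V lam : {vspace V} :=
  pred_vspace (fun v => forall x : subvs_of h, gen_eigen (lmod_action V (vsval x)) (lam x) v).

Lemma gwtP V lam (v : V) :
  reflect (forall x : subvs_of h, gen_eigen (lmod_action V (vsval x)) (lam x) v)
          (v \in gwt V lam).
Proof.
apply: pred_vspaceP; split=> [x|k u w ug wg x]; first exact: gen_eigen0.
exact: (gen_eigen_lin _ _).2.
Qed.

Lemma gwt_bilinear V1 V2 V3 (B : V1 -> V2 -> V3) a b :
    (forall v, linear (B^~ v)) -> (forall u, linear (B u)) ->
    (forall x u v, x \in h -> lmod_action V3 x (B u v)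
      = B (lmod_action V1 x u) v + B u (lmod_action V2 x v)) ->
  forall u v, u \in gwt V1 a -> v \in gwt V2 b -> B u v \in gwt V3 (a + b).
Proof.
move=> Bl Br hB u v /gwtP ua /gwtP vb; apply/gwtP => x; rewrite add_lfunE.
by apply: gen_eigen_bilinear (ua x) (vb x) => // u' v'; apply: hB (subvsP x).
Qed.

Lemma lmod_actionA V x y (v : V) : lmod_action V x (lmod_action V y v)
  = lmod_action V (bracket x y) v + lmod_action V y (lmod_action V x v).
Proof. by rewrite lmod_action_bracket subrK. Qed.

Lemma lmod_action_linl V (v : V) : linear (fun x => lmod_action V x v).
Proof. by move=> k x y; rewrite linearP add_lfunE scale_lfunE. Qed.

Lemma lmod_action_linr V x : linear (lmod_action V x).
Proof. by move=> k u v; rewrite linearP. Qed.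

Lemma gwt_action V a b x (v : V) : x \in gwt (adjoint g) a -> v \in gwt V b ->
  lmod_action V x v \in gwt V (b + a).
Proof.
rewrite addrC; apply: (gwt_bilinear (V1 := adjoint g)
   (B := fun (x : adjoint g) (v : V) => lmod_action V x v)).
- exact: lmod_action_linl.
- exact: lmod_action_linr.
- by move=> y u w _; rewrite lmod_actionA adjointE.
Qed.

Hypothesis hnil : lie_nilpotent h.

Lemma nilpotent_gwt0 x y : x \in h -> y \in h -> gen_eigen (ad x) 0 y.
Proof.
move=> xh yh; have [n hn] := hnil; apply: (@gen_eigen_nilp _ _ _ n).
apply/eqP; rewrite -memv0 -hn; elim: n {hn} => [//|n IHn].
by rewrite iterS adE; apply: memv_lie_prod.
Qed.

(** Apply gen_eigen_bilinear to the action: y has generalized eigenvalue 0 under ad x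
    because h is nilpotent. *)
Lemma gen_eigen_action_stable V x y c (v : V) : x \in h -> y \in h ->
  gen_eigen (lmod_action V x) c v -> gen_eigen (lmod_action V x) c (lmod_action V y v).
Proof.
move=> xh yh vc; rewrite -[c]add0r.
apply: (gen_eigen_bilinear (f1 := ad x) (B := fun (x : adjoint g) (v : V) => lmod_action V x v)
   _ _ _ _ vc).
- exact: lmod_action_linl.
- exact: lmod_action_linr.
- by move=> z w; rewrite lmod_actionA adE.
- exact: nilpotent_gwt0.
Qed.

Lemma gwt_stable V lam x (v : V) :
  x \in h -> v \in gwt V lam -> lmod_action V x v \in gwt V lam.
Proof.
move=> xh /gwtP vl; apply/gwtP => y.
exact: gen_eigen_action_stable (subvsP y) xh (vl y).
Qed.

(** Induction on the dimension of U. If some x in h has two eigenvalues on U, its generalized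
    eigenspaces in U are smaller and stable under h. Otherwise U lies in one weight space:
    the eigenvalue of x on U is the trace of x on U divided by the dimension, so it is
    linear in x. *)
Lemma gwt_span V (U X : {vspace V}) : submodule h U ->
  (forall lam u, u \in U -> u \in gwt V lam -> u \in X) -> (U <= X)%VS.
Proof.
have [n] := ubnP (\dim U); elim: n => // n IHn in U *; rewrite ltnS => le_n hU UX.
have [single|/existsNP[x /not_implyP[xh /forallNP xN]]] := pselect (forall x, x \in h ->
    exists c, forall u, u \in U -> gen_eigen (lmod_action V x) c u); last first.
  apply: (gen_eigen_span (f := lmod_action V x)) => [u uU|c u uU uc]; first exact: hU.
  pose Uc := (U :&: pred_vspace (gen_eigen (lmod_action V x) c))%VS.
  have UcP w : reflect (w \in U /\ gen_eigen (lmod_action V x) c w) (w \in Uc).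
    rewrite memv_cap; apply: (iffP andP) => -[wU wc]; split=> //;
      by apply/pred_vspaceP => //; exact: gen_eigen_lin.
  suff /subvP sUc : (Uc <= X)%VS by apply/sUc/UcP.
  apply: IHn.
  - apply: leq_trans le_n; rewrite ltn_neqAle dimvS ?capvSl // andbT.
    apply/negP => dU; have /eqP UcE : Uc == U by rewrite eqEdim capvSl (eqP dU) leqnn.
    by apply: (xN c) => w; rewrite -UcE => /UcP[].
  - move=> y w yh /UcP[wU wc]; apply/UcP; split; first exact: hU.
    exact: gen_eigen_action_stable.
  - by move=> lam w /UcP[wU _]; exact: UX.
have [->|U0] := eqVneq U 0%VS; first exact: sub0v.
pose p := projv U.
have pp : (p \o p)%VF = p by apply/lfunP => v; rewrite comp_lfunE projv_proj.
have [m pm m0] := lftrace_idempotent pp.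
have {m0} p0 : lftrace p != 0.
  rewrite pm pnatr_eq0 m0; apply: contraNneq U0 => p0.
  rewrite -subv0; apply/subvP => u uU.
  by rewrite memv0 -(projv_id uU) -/p p0 lfunE.
have [lam lamE] : exists lam : dualv h, forall x,
    lam x = lftrace (lmod_action V (vsval x) \o p)%VF / lftrace p.
  apply: (@linear_lfun _ (subvs_of h) F^o) => k x y.
  by rewrite !linearP /= comp_lfunDl -comp_lfunZl lftraceD lftraceZ mulrDl -mulrA.
apply/subvP => u uU; apply: (UX lam) => //; apply/gwtP => x.
have [c xc] := single _ (subvsP x); suff -> : lam x = c by exact: xc.
rewrite lamE (@lftrace_gen_eigen _ _ _ _ c) ?mulfK // => v; last by apply/xc/memv_proj.
by rewrite projv_id // hU ?subvsP ?memv_proj.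
Qed.

(** Induction on s: a power of x - a x, for some x on which a and b differ, kills the
    component for a and is injective on the weight space of b. *)
Lemma gwt_independent V (s : seq (dualv h)) (v : dualv h -> V) : uniq s ->
  {in s, forall a, v a \in gwt V a} ->
  \sum_(a <- s) v a = 0 -> {in s, forall a, v a = 0}.
Proof.
elim: s v => [//|a s IH] v /= /andP[aNs us] vE sum0.
have vs0 : {in s, forall b, v b = 0}.
  move=> b bs; have ab : a != b by apply: contraNneq aNs => ->.
  have [x /eqP xab] : exists x, a x <> b x.
    by apply/existsNP => abE; case/eqP: ab; apply/lfunP.
  have /gwtP/(_ x)[n an] := vE a (mem_head _ _).
  pose f := subscalar (lmod_action V (vsval x)) (a x).
  have fst c m w : w \in gwt V c -> iter m f w \in gwt V c.
    move=> wc; elim: m => [//|m IHm]; rewrite iterS subscalarE memvB ?memvZ //.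
    by apply: gwt_stable IHm; exact: subvsP.
  have bas : b \in a :: s by rewrite inE bs orbT.
  apply: (gen_eigen_uniq xab); last by have /gwtP := vE b bas; apply.
  exists n; apply: (IH (fun c => iter n f (v c))) => //.
    by move=> c cs; apply: fst; apply: vE; rewrite inE cs orbT.
  have fsum (r : seq (dualv h)) : iter n f (\sum_(c <- r) v c) = \sum_(c <- r) iter n f (v c).
    elim: r => [|c r IHr]; first by rewrite !big_nil iter_lfun0.
    by rewrite !big_cons -[v c]scale1r iter_lfun_lin !scale1r IHr.
  by have := fsum (a :: s); rewrite sum0 iter_lfun0 big_cons an add0r.
move=> b; rewrite inE => /orP[/eqP ->|/vs0 //].
by move: sum0; rewrite big_cons big_seq big1 ?addr0.
Qed.

(** A sum of weight spaces of maximal dimension contains all of them, hence is V. *)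
Lemma weights_exist V : exists s : seq (dualv h),
  uniq s /\ {:V}%VS = (\sum_(a <- s) gwt V a)%VS.
Proof.
pose Q (U : {vspace V}) := exists2 s : seq (dualv h), uniq s & U = (\sum_(a <- s) gwt V a)%VS.
have [|U [s us UE] maxU] := @vspace_max _ _ Q 0%VS; first by exists [::]; rewrite ?big_nil.
exists s; split=> //; rewrite -UE; apply/eqP; rewrite eqEsubv subvf andbT.
apply: gwt_span => [x v _ _|a v _ va]; first exact: memvf.
have [as_|as_] := boolP (a \in s).
  by rewrite UE (big_rem a) //=; apply: subvP va; exact: addvSl.
have Qa : Q (gwt V a + U)%VS by exists (a :: s); rewrite /= ?as_ // big_cons UE.
have /eqP -> : U == (gwt V a + U)%VS by rewrite eqEdim addvSr maxU.
by apply: subvP va; exact: addvSl.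
Qed.

Definition weights V : seq (dualv h) := projT1 (cid (weights_exist V)).

Lemma weights_uniq V : uniq (weights V).
Proof. by rewrite /weights; case: cid => s []. Qed.

Lemma weights_sum V : {:V}%VS = (\sum_(a <- weights V) gwt V a)%VS.
Proof. by rewrite /weights; case: cid => s []. Qed.

Definition wproj V a : 'End(V) := sumv_pi_for (weights_sum V) a.

Lemma wproj_mem V a v : wproj V a v \in gwt V a.
Proof. exact: memv_sum_pi. Qed.

Lemma wproj_sum V v : \sum_(a <- weights V) wproj V a v = v.
Proof. by apply: sumv_pi_uniq_sum; rewrite ?filter_predT ?weights_uniq ?memvf. Qed.

Lemma mem_weights V a (v : V) : v \in gwt V a -> v != 0 -> a \in weights V.
Proof.
move=> va; apply: contra_neqT => aN.
pose w b := if b == a then - v else wproj V b v.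
have wE b : b \in weights V -> w b = wproj V b v.
  by rewrite /w; case: eqP aN => // -> /negPf ->.
have : w a = 0; last by rewrite /w eqxx => /eqP; rewrite oppr_eq0 => /eqP.
apply: (@gwt_independent V (a :: weights V)) (mem_head _ _) => /=.
- by rewrite aN weights_uniq.
- move=> b _; rewrite /w; case: eqP => [->|_]; first by rewrite memvN.
  exact: wproj_mem.
- by rewrite big_cons (eq_big_seq _ wE) wproj_sum /w eqxx addNr.
Qed.

Lemma wprojE V a b v : v \in gwt V b -> wproj V a v = if a == b then v else 0.
Proof.
move=> vb; have [->|v0] := eqVneq v 0; first by rewrite linear0 if_same.
pose w c := wproj V c v - if c == b then v else 0.
have [as_|aN] := boolP (a \in weights V); last first.
  have [ab|ab] := eqVneq a b; first by rewrite ab (mem_weights vb v0) in aN.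
  by apply: contraNeq aN; exact: mem_weights (wproj_mem _ _).
suff : w a = 0 by move=> /eqP; rewrite subr_eq0 => /eqP.
apply: (gwt_independent (weights_uniq V)) as_ => [c _|].
  by rewrite memvB ?wproj_mem //; case: eqP => [->//|_]; rewrite mem0v.
rewrite sumrB wproj_sum (bigD1_seq b) ?(mem_weights vb) ?weights_uniq //= eqxx.
by rewrite big1 ?addr0 ?subrr // => c /negPf ->.
Qed.

Lemma wproj_idem V a : (wproj V a \o wproj V a)%VF = wproj V a.
Proof. by apply/lfunP => v; rewrite comp_lfunE (wprojE _ (wproj_mem a v)) eqxx. Qed.

Lemma wproj_stable V (U : {vspace V}) a v : submodule h U -> v \in U -> wproj V a v \in U.
Proof.
move=> hU; rewrite memv_preim; move: v; apply/subvP/gwt_span => // b v vU vb.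
rewrite -memv_preim (wprojE _ vb).
by case: ifP; rewrite ?mem0v.
Qed.

Lemma wproj0_eq V (W : vectType F) (f : 'Hom(V, W)) v :
  (forall a, a != 0 -> f (wproj V a v) = 0) -> f v = f (wproj V 0 v).
Proof.
move=> f0; rewrite -{1}(wproj_sum v) linear_sum.
have [w0|wN] := boolP (0 \in weights V).
  by rewrite (bigD1_seq 0) ?weights_uniq //= big1 ?addr0.
have -> : wproj V 0 v = 0 by apply: contraNeq wN; exact: mem_weights (wproj_mem _ _).
rewrite linear0 big1_seq // => a /andP[_ aw]; apply: f0.
by apply: contraNneq wN => <-.
Qed.

Lemma dual_mulrn_inj a : a != 0 -> injective (fun n => a *+ n).
Proof.
move=> a0 n m; wlog le_nm : n m / (n <= m)%N.
  by move=> IH; have [/IH//|/ltnW/IH IH' /esym /IH' ->] := leqP n m.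
move=> /eqP; rewrite eq_sym -subr_eq0 -mulrnBr // -scaler_nat scaler_eq0.
by rewrite (negPf a0) orbF pnatr_eq0 subn_eq0 => ?; apply/eqP; rewrite eqn_leq le_nm.
Qed.

(** The weights b + n a are pairwise distinct, and V has finitely many weights. *)
Lemma gwt_shift_eq0 V a b : a != 0 -> exists n, gwt V (b + a *+ n) = 0%VS.
Proof.
move=> a0; apply: contrapT => /forallNP shN.
pose s := [seq b + a *+ i | i <- iota 0 (size (weights V)).+1].
have us : uniq s.
  by rewrite map_inj_uniq ?iota_uniq // => i j /addrI /(dual_mulrn_inj a0).
suff /(uniq_leq_size us) : {subset s <= weights V}.
  by rewrite size_map size_iota ltnn.
move=> _ /mapP[i _ ->]; apply: (mem_weights (memv_pick _)).
by rewrite vpick0; apply/eqP/shN.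
Qed.

(** There are finitely many weights, so an operator shifting them by a nonzero
    amount is nilpotent. *)
Lemma shift_nilpotent V (f : 'End(V)) a : a != 0 ->
    (forall b v, v \in gwt V b -> f v \in gwt V (b + a)) ->
  forall v, gen_eigen f 0 v.
Proof.
move=> a0 fa v; suff /subvP/(_ v (memvf v)) : ({:V} <= pred_vspace (gen_eigen f 0))%VS.
  by move/pred_vspaceP; apply; exact: gen_eigen_lin.
apply: gwt_span => [x u _ _|b u _ ub]; first exact: memvf.
apply/pred_vspaceP; first exact: gen_eigen_lin.
have [n bn] := gwt_shift_eq0 V b a0; apply: (@gen_eigen_nilp _ _ _ n).
apply/eqP; rewrite -memv0 -bn; elim: n {bn} => [|n IHn]; first by rewrite addr0.
by rewrite iterS mulrSr addrA; exact: fa.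
Qed.

End Weights.

(** * Engel's theorem *)

Section Engel.
Variables (F : fieldType) (g : lieAlgType F).

(** Jacobson's form of Engel's theorem: W is only assumed to be closed under
    brackets, not to be a subspace. Call K nil if its action on the quotients of V by proper
    stable subspaces always has a nonzero invariant, and let K be a nil subspace spanned by
    elements of W, of maximal dimension. If K did not contain W, then, by nilness, W would
    contain b outside K with [K, b] in K, and K + <b> would still be nil. *)
Lemma engel (V : {vspace g}) (W : g -> Prop) :
    (forall w, W w -> w \in V) ->
    (forall w w', W w -> W w' -> W (bracket w w')) ->
    (forall w v, W w -> v \in V -> bracket w v \in V) ->
    (forall w v, W w -> v \in V -> gen_eigen (ad w) 0 v) ->
  forall U : {vspace g}, (U <= V)%VS -> (forall w u, W w -> u \in U -> bracket w u \in U) ->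
    U != V -> exists v, [/\ v \in V, v \notin U & forall w, W w -> bracket w v \in U].
Proof.
move=> WV WW sV nW.
pose nil (K : {vspace g}) := forall U : {vspace g}, (U <= V)%VS ->
  {in K & U, forall k u, bracket k u \in U} -> U != V ->
  exists v, [/\ v \in V, v \notin U & {in K, forall k, bracket k v \in U}].
pose spanned (K : {vspace g}) := forall X : {vspace g},
  (forall w, W w -> w \in K -> w \in X) -> (K <= X)%VS.
have [|K [sK nK] maxK] := @vspace_max _ _ (fun K => spanned K /\ nil K) 0%VS.
  split=> [X _|U UV _ UnV]; first exact: sub0v.
  have /subvPn[v vV vU] : ~~ (V <= U)%VS by apply: contra UnV => VU; rewrite eqEsubv UV.
  by exists v; split=> // k; rewrite memv0 => /eqP ->; rewrite bracketC linear0 oppr0 mem0v.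
have KV : (K <= V)%VS by apply: sK => w Ww _; exact: WV.
suff WK w : W w -> w \in K.
  move=> U UV WU UnV; have [|v [vV vU Kv]] := nK U UV _ UnV.
    move=> k u kK uU; rewrite -[bracket k u]/(bracketr u k) -lfunE memv_preim.
    move: k kK; apply/subvP/sK => w Ww _; rewrite -memv_preim lfunE; exact: WU.
  by exists v; split=> // w /WK; exact: Kv.
move=> Ww; apply: contrapT => /negP wK.
(* enlarging a maximal such U by a vector invariant modulo U produces b *)
pose Q (U : {vspace g}) := [/\ (U <= V)%VS, {in K & U, forall k u, bracket k u \in U}
  & forall b, W b -> b \in U -> b \in K].
have [|U [UV KU UWK] maxU] := @vspace_max _ _ Q 0%VS.
  split=> [|k u _|b _]; first exact: sub0v.
    by rewrite memv0 => /eqP ->; rewrite linear0 mem0v.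
  by rewrite memv0 => /eqP ->; rewrite mem0v.
have UnV : U != V by apply: contraNneq wK => UE; rewrite UWK // UE WV.
have [v [vV vU Kv]] := nK U UV KU UnV.
have KU1 : {in K & (U + <[v]>)%VS, forall k u, bracket k u \in U}.
  move=> k _ kK /memv_addP[u uU [_ /vlineP[c ->] ->]].
  by rewrite linearD linearZ memvD ?KU ?memvZ ?Kv.
have [b [Wb bU1 bK]] : exists b, [/\ W b, b \in (U + <[v]>)%VS & b \notin K].
  apply: contrapT => nb; case/negP: vU.
  have /maxU dU : Q (U + <[v]>)%VS.
    split=> [|k u kK uU|b Wb bU].
    - by rewrite subv_add UV; apply/subvP => _ /vlineP[c ->]; rewrite memvZ.
    - by apply: subvP (addvSl _ _) _ _; apply: KU1.
    - by apply: contrapT => /negP bK; apply: nb; exists b.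
  have /eqP -> : U == (U + <[v]>)%VS by rewrite eqEdim addvSl.
  by rewrite (subvP (addvSr _ _)) ?memv_line.
have Kb : {in K, forall k, bracket k b \in K}.
  move=> k kK; rewrite -[bracket k b]/(bracketr b k) -lfunE memv_preim.
  move: k kK; apply/subvP/sK => k Wk kK; rewrite -memv_preim lfunE.
  by apply: UWK; [exact: WW | exact: KU1].
case/negP: bK; suff /maxK dK : spanned (K + <[b]>)%VS /\ nil (K + <[b]>)%VS.
  have /eqP -> : K == (K + <[b]>)%VS by rewrite eqEdim addvSl.
  by rewrite (subvP (addvSr _ _)) ?memv_line.
split=> [X WX|{U UV KU UWK maxU UnV vU Kv KU1 bU1} U UV KU UnV].
  rewrite subv_add; apply/andP; split.
    by apply: sK => k Wk kK; apply: WX; rewrite ?(subvP (addvSl _ _)).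
  apply/subvP => _ /vlineP[c ->]; rewrite memvZ // WX //.
  by rewrite (subvP (addvSr _ _)) ?memv_line.
have bU u : u \in U -> bracket b u \in U.
  by apply: KU; rewrite (subvP (addvSr _ _)) ?memv_line.
have {}KU : {in K & U, forall k u, bracket k u \in U}.
  by move=> k u kK; apply: KU; rewrite (subvP (addvSl _ _)).
have {vV}[v0 [v0V v0U Kv0]] := nK U UV KU UnV.
have itK m : iter m (ad b) v0 \in V /\ {in K, forall k, bracket k (iter m (ad b) v0) \in U}.
  elim: m => [//|m [IHV IHU]]; rewrite iterS adE; split=> [|k kK]; first exact: sV.
  by rewrite bracketA memvD ?bU ?IHU ?Kb.
have [n] := nW _ _ Wb v0V; rewrite subscalar0 => itn.
have [m mU mS] : exists2 m, iter m (ad b) v0 \notin U & iter m.+1 (ad b) v0 \in U.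
  have : iter n (ad b) v0 \in U by rewrite itn mem0v.
  elim: n {itn} => [|n IHn]; first by rewrite /= (negPf v0U).
  by have [/IHn //|nU nS] := boolP (iter n (ad b) v0 \in U); exists n.
have [mV mK] := itK m; exists (iter m (ad b) v0); split=> //.
move=> _ /memv_addP[k kK [_ /vlineP[c ->] ->]].
by rewrite bracketDl bracketZl memvD ?mK ?memvZ // -adE.
Qed.

End Engel.

(** * The Killing form *)

Section Killing.
Variables (F : fieldType) (g : lieAlgType F).
Implicit Types (x y z : g) (I U : {vspace g}).

Lemma bracketNl x y : bracket (- x) y = - bracket x y.
Proof. by rewrite -scaleN1r bracketZl scaleN1r. Qed.

Lemma ad_bracket x y : ad (bracket x y) = ((ad x \o ad y) - (ad y \o ad x))%VF.
Proof.
apply/lfunP => z; rewrite add_lfunE opp_lfunE !comp_lfunE !adE.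
by rewrite [bracket x (bracket y z)]bracketA addrK.
Qed.

Definition killing x y : F := lftrace (ad x \o ad y)%VF.

Lemma killingC x y : killing x y = killing y x.
Proof. exact: lftraceC. Qed.

Lemma killing_invariant x y z : killing (bracket x y) z = killing x (bracket y z).
Proof.
rewrite /killing !ad_bracket comp_lfunDl comp_lfunNl comp_lfunDr comp_lfunNr !lftraceB.
by rewrite -!comp_lfunA [lftrace (ad y \o _)%VF]lftraceC -!comp_lfunA.
Qed.

Lemma killing_linear x : linear (killing x : g -> F^o).
Proof.
move=> k y z; rewrite /killing linearP comp_lfunDr -comp_lfunZr lftraceD lftraceZ.
by [].
Qed.

Lemma killingDl x y z : killing (x + y) z = killing x z + killing y z.
Proof.
rewrite ![killing _ z]killingC; have := killing_linear z 1 x y.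
by rewrite !scale1r.
Qed.

Lemma killingZl k x z : killing (k *: x) z = k * killing x z.
Proof.
rewrite ![killing _ z]killingC; have := killing_linear z k x 0.
have := killing_linear z 1 0 0; rewrite !scale1r !addr0.
by move=> /eqP; rewrite -subr_eq subrr eq_sym => /eqP ->; rewrite addr0.
Qed.

Lemma killingDr x y z : killing x (y + z) = killing x y + killing x z.
Proof. by rewrite !(killingC x) killingDl. Qed.

Lemma killingZr k x z : killing x (k *: z) = k * killing x z.
Proof. by rewrite !(killingC x) killingZl. Qed.

Lemma killing0r x : killing x 0 = 0.
Proof. by rewrite -(scale0r 0) killingZr mul0r. Qed.

Definition killing_orthogonal U : {vspace g} :=
  pred_vspace (fun x => {in U, forall y, killing x y = 0}).

Lemma killing_orthogonalP U x :
  reflect {in U, forall y, killing x y = 0} (x \in killing_orthogonal U).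
Proof.
apply: pred_vspaceP; split=> [y _|k u v uU vU y yU]; first by rewrite killingC killing0r.
by rewrite killingDl killingZl uU ?vU // mulr0 addr0.
Qed.

Lemma killing_orthogonal_ideal I : lie_ideal I -> lie_ideal (killing_orthogonal I).
Proof.
move=> idI x y /killing_orthogonalP yI; apply/killing_orthogonalP => z zI.
by rewrite bracketC -scaleN1r killingZl killing_invariant yI ?mulr0 // idI.
Qed.

Lemma lie_prod_ideal I : lie_ideal I -> lie_ideal (lie_prod I I).
Proof.
move=> idI x y yP; rewrite -adE memv_preim; move: y yP; apply/subvP.
apply/lie_prod_subP => u v uI vI; rewrite -memv_preim adE bracketA.
by rewrite memvD ?memv_lie_prod ?idI.
Qed.

Lemma derived_series_ideal I n : lie_ideal I -> lie_ideal (derived_series I n).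
Proof. by move=> idI; elim: n => [//|n]; exact: lie_prod_ideal. Qed.

Lemma lie_prod_ideal_sub I : lie_ideal I -> (lie_prod I I <= I)%VS.
Proof. by move=> idI; apply/lie_prod_subP => u v _; exact: idI. Qed.

Lemma derived_series_sub I n : lie_ideal I -> (derived_series I n <= I)%VS.
Proof.
move=> idI; elim: n => [|n]; first exact: subvv.
by apply: subv_trans; apply/lie_prod_ideal_sub/derived_series_ideal.
Qed.

(** Take the term of least dimension in the derived series. *)
Lemma perfect_ideal I : lie_ideal I -> ~ lie_solvable I ->
  exists P, [/\ lie_ideal P, (P <= I)%VS, P != 0%VS & lie_prod P P = P].
Proof.
move=> idI nsolv.
have [|P [n PE] minP] := @vspace_min _ _ (fun U => exists n, U = derived_series I n) I.
  by exists 0%N.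
have idP : lie_ideal P by rewrite PE; exact: derived_series_ideal.
exists P; split=> //.
- by rewrite PE derived_series_sub.
- by apply/eqP => P0; apply: nsolv; exists n; rewrite -PE.
- apply/eqP; rewrite eqEdim lie_prod_ideal_sub // minP //.
  by exists n.+1; rewrite PE.
Qed.

End Killing.

Section IterComm.
Variables (F : fieldType) (V : vectType F).

Lemma iter_comp_comm (f f' : 'End(V)) n v : (forall u, f (f' u) = f' (f u)) ->
  iter n (f \o f')%VF v = iter n f (iter n f' v).
Proof.
move=> ff'; have c m u : f (iter m f' u) = iter m f' (f u).
  by elim: m => [//|m IHm]; rewrite !iterS ff' IHm.
by elim: n v => [//|n IHn] v; rewrite [in LHS]iterSr IHn comp_lfunE -c -!iterSr.
Qed.

Lemma gen_eigen_square (f : 'End(V)) c v : gen_eigen f c v -> gen_eigen (f \o f)%VF (c ^+ 2) v.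
Proof.
move=> [n vn]; exists n.
have -> : subscalar (f \o f)%VF (c ^+ 2) = (subscalar f (- c) \o subscalar f c)%VF.
  apply/lfunP => u; rewrite comp_lfunE !subscalarE comp_lfunE (linearB f) (linearZ_LR f).
  by rewrite scaleNr opprK scalerBr scalerA -expr2 addrA subrK.
rewrite iter_comp_comm ?vn ?iter_lfun0 // => u.
rewrite !subscalarE !(linearB f) !(linearZ_LR f) !scalerBr !scalerA mulrC !opprB.
by rewrite addrACA [RHS]addrACA [- _ - _]addrC.
Qed.

End IterComm.

(** * Cartan subalgebras *)

Section Cartan.
Variable (C : numClosedFieldType).
Let F : fieldType := C.
Variables (g : lieAlgType F) (h : {vspace g}).
Hypothesis hh : cartan_subalg h.
Implicit Types (a b c : dualv h) (x y z : g).

Let hsub : lie_subalg h. Proof. by case: hh. Qed.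
Let hnil : lie_nilpotent h. Proof. by case: hh. Qed.

Definition grs a : {vspace g} := gwt (adjoint g) a.
(** The projection onto h makes a total on g; only the values at elements of h are
    meaningful. *)
Definition ev a x : F := a (vsproj h x).
Definition gproj a : 'End(g) := wproj hnil (adjoint g) a.
Definition gwts : seq (dualv h) := weights hnil (adjoint g).
(** The dimension of the generalized root space, as a scalar. *)
Definition mult a : F := lftrace (gproj a).

Lemma evE a x (xh : x \in h) : ev a x = a (Subvs xh).
Proof. by congr (a _); apply: val_inj; rewrite /= vsprojK. Qed.

Lemma evD a x y : ev a (x + y) = ev a x + ev a y.
Proof. by rewrite /ev !linearD. Qed.

Lemma evZ a k x : ev a (k *: x) = k * ev a x.
Proof. by rewrite /ev !linearZ. Qed.

Lemma ev_add a b x : ev (a + b) x = ev a x + ev b x.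
Proof. by rewrite /ev add_lfunE. Qed.

Lemma ev_opp a x : ev (- a) x = - ev a x.
Proof. by rewrite /ev opp_lfunE. Qed.

Lemma ev_mulrn a n x : ev (a *+ n) x = ev a x *+ n.
Proof.
elim: n => [|n IHn]; first by rewrite /ev lfunE.
by rewrite !mulrSr ev_add IHn.
Qed.

Lemma ev_neq0 a : a != 0 -> exists2 x, x \in h & ev a x != 0.
Proof.
move=> a0; have [w aw] : exists w, a w <> 0.
  by apply/existsNP => aE; case/eqP: a0; apply/lfunP => w; rewrite aE lfunE.
exists (vsval w); first exact: subvsP.
by rewrite (evE _ (subvsP w)); apply/eqP; move: aw; congr (a _ <> 0); apply: val_inj.
Qed.

Lemma gwt_ev (V : lieModule g) a x (v : V) : x \in h -> v \in gwt V a ->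
  gen_eigen (lmod_action V x) (ev a x) v.
Proof. by move=> xh /gwtP/(_ (Subvs xh)); rewrite (evE _ xh). Qed.

Lemma lmod_adjoint x : lmod_action (adjoint g) x = ad x.
Proof. by apply/lfunP => y; rewrite adjointE adE. Qed.

Lemma grsP a y :
  reflect (forall x : subvs_of h, gen_eigen (ad (vsval x)) (a x) y) (y \in grs a).
Proof.
by apply: (iffP (@gwtP C g h (adjoint g) a y)) => ya x;
  have := ya x; rewrite lmod_adjoint.
Qed.

Lemma grs_ev a x v : x \in h -> v \in grs a -> gen_eigen (ad x) (ev a x) v.
Proof. by move=> xh /grsP/(_ (Subvs xh)); rewrite (evE _ xh). Qed.

Lemma bracket_grs a b x y : x \in grs a -> y \in grs b -> bracket x y \in grs (a + b).
Proof.
move=> xa yb; have := @gwt_action C g h (adjoint g) a b x y xa yb.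
by rewrite adjointE addrC.
Qed.

Lemma root_space_grs a : (root_space a <= grs a)%VS.
Proof.
apply/subvP => y /root_spaceP ya; apply/grsP => x.
by apply: gen_eigen_eigen; rewrite adE ya.
Qed.

Lemma grs_span (U X : {vspace g}) : {in h & U, forall x u, bracket x u \in U} ->
  (forall a u, u \in U -> u \in grs a -> u \in X) -> (U <= X)%VS.
Proof.
move=> hU UX; apply: (gwt_span hnil (V := adjoint g)) => [x u xh uU|].
  by rewrite adjointE hU.
exact: UX.
Qed.

Lemma grs_spanT (X : {vspace g}) : (forall a u, u \in grs a -> u \in X) -> forall u, u \in X.
Proof.
move=> UX u; apply: (subvP (_ : {:g} <= X)%VS) (memvf u).
by apply: grs_span => [x v _ _|a v _]; [exact: memvf | exact: UX].
Qed.

Lemma eq_on_grs (W : vectType F) (f f' : 'Hom(g, W)) :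
  (forall a u, u \in grs a -> f u = f' u) -> f = f'.
Proof.
move=> ff'; apply/lfunP => u; apply/eqlfunP; move: u; apply: grs_spanT => a u ua.
exact/eqlfunP/(ff' a).
Qed.

(** h acts nilpotently on the weight space of 0. If h were smaller, Engel's theorem would
    give an element outside h normalizing h. *)
Lemma grs0 : grs 0 = h.
Proof.
apply/eqP; rewrite eqEsubv andbC; apply/andP; split.
  apply/subvP => x xh; apply/grsP => y; rewrite lfunE.
  exact: (nilpotent_gwt0 hnil (subvsP y) xh).
apply: contrapT => /negP hn.
have hg : (h <= grs 0%R)%VS.
  apply/subvP => x xh; apply/grsP => y; rewrite lfunE.
  exact: (nilpotent_gwt0 hnil (subvsP y) xh).
have st w v : w \in h -> v \in grs 0 -> bracket w v \in grs 0.
  by move=> wh v0; rewrite -[0]addr0; apply: bracket_grs => //; exact: subvP hg _ wh.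
have [] := @engel _ g (grs 0) (fun x => x \in h) (subvP hg) hsub st _ h hg hsub.
- move=> w v wh v0; have := grs_ev wh v0.
  by rewrite /ev lfunE.
- by apply: contraNneq hn => <-.
move=> v [v0 vh wv]; case/negP: vh; have [_ _] := hh; apply => y yh.
by rewrite bracketC memvN wv.
Qed.

Lemma gproj_mem a x : gproj a x \in grs a.
Proof. exact: (wproj_mem hnil (V := adjoint g)). Qed.

Lemma gproj_sum x : \sum_(a <- gwts) gproj a x = x.
Proof. exact: (wproj_sum hnil (V := adjoint g)). Qed.

Lemma gprojE a b x : x \in grs b -> gproj a x = if a == b then x else 0.
Proof. exact: (wprojE hnil (V := adjoint g)). Qed.

Lemma gproj_idem a : (gproj a \o gproj a)%VF = gproj a.
Proof. exact: (@wproj_idem C g h hnil (adjoint g) a). Qed.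

Lemma gproj_stable (U : {vspace g}) a v :
  {in h & U, forall x u, bracket x u \in U} -> v \in U -> gproj a v \in U.
Proof.
move=> hU vU; apply: (@wproj_stable C g h hnil (adjoint g) U a v _ vU) => x u xh uU.
by rewrite adjointE hU.
Qed.

Lemma mult_nat a : exists2 n : nat, mult a = n%:R & (n == 0%N) = (grs a == 0%VS).
Proof.
have [n nE n0] := lftrace_idempotent (gproj_idem a); exists n => //; rewrite n0.
apply/eqP/eqP => [p0|a0].
  apply/eqP; rewrite -subv0; apply/subvP => x xa.
  by have := gprojE a xa; rewrite eqxx p0 lfunE => <-; rewrite memv0.
by apply/lfunP => x; apply/eqP; rewrite lfunE -memv0 -a0 gproj_mem.
Qed.

Lemma mult_eq0 a : (mult a == 0) = (grs a == 0%VS).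
Proof. by have [n -> <-] := mult_nat a; rewrite pnatr_eq0. Qed.

Lemma mult_ge0 a : 0 <= (mult a : C).
Proof. by have [n -> _] := mult_nat a; rewrite ler0n. Qed.

Lemma mem_gwts a x : x \in grs a -> x != 0 -> a \in gwts.
Proof. exact: (mem_weights hnil (V := adjoint g)). Qed.

Lemma grs_gwts a : grs a != 0%VS -> a \in gwts.
Proof. by rewrite -vpick0; apply: mem_gwts; exact: memv_pick. Qed.

Lemma lftrace_gproj (f : 'End(g)) : lftrace f = \sum_(a <- gwts) lftrace (f \o gproj a)%VF.
Proof.
rewrite -lftrace_sum; congr lftrace; apply/lfunP => x; rewrite sum_lfunE.
rewrite -{1}(gproj_sum x) linear_sum /=; apply: eq_bigr => a _.
by rewrite comp_lfunE.
Qed.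

(** A nonzero shift of weights is nilpotent. *)
Lemma lftrace_shift (V : lieModule g) (f : 'End(V)) a : a != 0 ->
    (forall b v, v \in gwt V b -> f v \in gwt V (b + a)) -> lftrace f = 0.
Proof.
move=> a0 fa; have [n fn] := gen_eigen_nilpotent_unif (shift_nilpotent hnil a0 fa).
by apply: (lftrace_nilpotent (k := n)) => v; rewrite -[RHS](fn v) subscalar0.
Qed.

Lemma lftrace_ad_gproj x a : x \in h -> lftrace (ad x \o gproj a)%VF = ev a x * mult a.
Proof.
move=> xh; have st v : bracket x (gproj a v) \in grs a.
  by rewrite -[a in grs a]add0r; apply: bracket_grs; rewrite ?grs0 ?gproj_mem.
apply: lftrace_gen_eigen; first exact: gproj_idem.
  by move=> v; rewrite adE (gprojE _ (st v)) eqxx.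
by move=> v; apply: grs_ev; rewrite ?gproj_mem.
Qed.

Lemma killing_cartan_square x : x \in h -> killing x x = \sum_(a <- gwts) ev a x ^+ 2 * mult a.
Proof.
move=> xh; rewrite /killing lftrace_gproj; apply: eq_bigr => a _.
have st v : v \in grs a -> bracket x v \in grs a.
  by move=> va; rewrite -[a in grs a]add0r; apply: bracket_grs; rewrite ?grs0.
apply: lftrace_gen_eigen; first exact: gproj_idem.
  move=> v; rewrite comp_lfunE !adE (@gprojE _ a) ?eqxx //.
  by apply/st/st/gproj_mem.
by move=> v; apply/gen_eigen_square/grs_ev; rewrite ?gproj_mem.
Qed.

(** Polarization of the previous formula; x and y are not yet known to commute. *)
Lemma killing_cartan x y : x \in h -> y \in h ->
  killing x y = \sum_(a <- gwts) ev a x * ev a y * mult a.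
Proof.
move=> xh yh; apply: (@mulfI _ (2%:R : F)); first by rewrite pnatr_eq0.
have -> : 2%:R * killing x y = killing (x + y) (x + y) - killing x x - killing y y.
  rewrite killingDl !killingDr (killingC y x) mulr_natl mulr2n.
  have alg (A B D : F) : B + B = A + B + (B + D) - A - D.
    by rewrite [B + D]addrC (addrACA A) -(addrA _ (- A)) -opprD [RHS]addrC addKr.
  exact: alg.
rewrite !killing_cartan_square ?memvD // -!sumrB mulr_sumr; apply: eq_bigr => a _.
rewrite evD -!mulrBl sqrrD [_ - _ - _]addrAC addrK [X in X * _]addrC addKr.
by rewrite mulr_natl mulrnAl.
Qed.

End Cartan.

(** * Cartan's criterion *)

Section Criterion.
Variable (C : numClosedFieldType).
Let F : fieldType := C.
Variables (g : lieAlgType F) (h : {vspace g}).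
Hypothesis hh : cartan_subalg h.
Implicit Types (a b c : dualv h) (x y z : g).
Local Notation gproj := (gproj hh).
Local Notation gwts := (gwts hh).
Local Notation mult := (mult hh).

(** The semisimple operator with eigenvalue k a on the root space of a. It is the projection
    onto a sum of root spaces when k takes the values 0 and 1. *)
Definition weight_scaling (k : dualv h -> F) : 'End(g) := \sum_(a <- gwts) k a *: gproj a.

Lemma weight_scalingE k c v : v \in grs c -> weight_scaling k v = k c *: v.
Proof.
move=> vc; rewrite sum_lfunE.
have tE a : (k a *: gproj a) v = if a == c then k c *: v else 0.
  by rewrite scale_lfunE (gprojE hh _ vc); case: eqP => [->|_]; rewrite ?scaler0.
rewrite (eq_bigr _ (fun a _ => tE a)) -big_mkcond.
have [->|v0] := eqVneq v 0; first by rewrite scaler0 big1.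
rewrite -big_filter filter_pred1_uniq ?big_seq1 ?weights_uniq //.
exact: (mem_gwts hh vc v0).
Qed.

Lemma weight_scaling_comm (k : dualv h -> F) (f : 'End(g)) a :
    (forall b, grs b != 0%VS -> grs (b + a) != 0%VS -> k (b + a) = k b) ->
    (forall b v, v \in grs b -> f v \in grs (b + a)) ->
  (weight_scaling k \o f = f \o weight_scaling k)%VF.
Proof.
have nz c v : v \in grs c -> v != 0 -> grs c != 0%VS.
  by move=> vc; apply: contraNneq => c0; move: vc; rewrite c0 memv0.
move=> Pa fa; apply: (@eq_on_grs C g h hh g) => c v vc.
rewrite !comp_lfunE (weight_scalingE _ vc) (weight_scalingE _ (fa _ _ vc)) (linearZ_LR f) /=.
have [->|fv0] := eqVneq (f v) 0; first by rewrite !scaler0.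
have v0 : v != 0 by apply: contraNneq fv0 => ->; rewrite linear0.
by rewrite Pa ?(nz _ _ vc v0) ?(nz _ _ (fa _ _ vc) fv0).
Qed.

Lemma lftrace_ad_weight_scaling k z : z \in h ->
  lftrace (ad z \o weight_scaling k)%VF = \sum_(a <- gwts) k a * (ev a z * mult a).
Proof.
move=> zh; have -> : (ad z \o weight_scaling k)%VF = \sum_(a <- gwts) k a *: (ad z \o gproj a)%VF.
  apply/lfunP => v; rewrite comp_lfunE !sum_lfunE linear_sum; apply: eq_bigr => a _.
  by rewrite !scale_lfunE comp_lfunE linearZ.
by rewrite lftrace_sum; apply: eq_bigr => a _; rewrite lftraceZ (lftrace_ad_gproj hh).
Qed.

(** Let z = [x, y]. The root spaces of the c such that (c - b)(z) is a real multiple of a(z)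
    span a subspace stable under x and y, so z has trace 0 on it; this trace is m b(z) plus
    a real multiple of a(z), where m is the dimension. *)
Lemma ev_bracket_real a b x y : x \in grs a -> y \in grs (- a) -> grs b != 0%VS ->
  exists2 r : C, r \is Num.real & ev b (bracket x y) = r * ev a (bracket x y).
Proof.
move=> xa ya b0; set z := bracket x y.
have zh : z \in h by have := bracket_grs xa ya; rewrite subrr (grs0 hh).
pose S (t : F) := exists2 r : C, r \is Num.real & t = r * ev a z.
have S0 : S 0 by exists 0; rewrite ?real0 // mul0r.
have SD t t' : S t -> S t' -> S (t + t').
  by move=> [r rr ->] [r' rr' ->]; exists (r + r'); rewrite ?realD ?mulrDl.
have Sr (k : C) t : k \is Num.real -> S t -> S (k * t).
  by move=> kr [r rr ->]; exists (k * r); rewrite ?realM ?mulrA.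
have Sa : S (ev a z) by exists 1; rewrite ?real1 ?mul1r.
have SN t : S t -> S (- t) by rewrite -mulN1r; apply: Sr; rewrite realN real1.
pose P c := `[< S (ev c z - ev b z) >]; pose k c : F := (P c)%:R.
have Pa c : P (c + a) = P c.
  apply/asboolP/asboolP => [/SD/(_ (SN _ Sa))|/SD/(_ Sa)]; rewrite ev_add.
    by rewrite addrAC addrK.
  by rewrite addrAC.
have PNa c : P (c - a) = P c by rewrite -(Pa (c - a)) subrK.
have cx : (weight_scaling k \o ad x = ad x \o weight_scaling k)%VF.
  by apply: (@weight_scaling_comm k _ a) => c;
    [by move=> _ _; rewrite /k Pa|move=> v vc]; rewrite adE addrC bracket_grs.
have cy : (weight_scaling k \o ad y = ad y \o weight_scaling k)%VF.
  by apply: (@weight_scaling_comm k _ (- a)) => c;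
    [by move=> _ _; rewrite /k PNa|move=> v vc]; rewrite adE addrC bracket_grs.
have : lftrace (ad z \o weight_scaling k)%VF = 0.
  rewrite ad_bracket comp_lfunDl comp_lfunNl lftraceB -!comp_lfunA -cx.
  by rewrite [lftrace (ad x \o _)%VF]lftraceC -comp_lfunA subrr.
rewrite lftrace_ad_weight_scaling //.
have -> : \sum_(c <- gwts) k c * (ev c z * mult c) = \sum_(c <- gwts | P c) ev c z * mult c.
  rewrite [RHS]big_mkcond; apply: eq_bigr => c _.
  by rewrite /k; case: ifP; rewrite ?mul1r ?mul0r.
move=> tr0.
have [M0 Mreal] : (\sum_(c <- gwts | P c) mult c : C) != 0 /\
    (\sum_(c <- gwts | P c) mult c : C) \is Num.real.
  have Pb : P b by apply/asboolP; rewrite subrr.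
  split; last by apply: rpred_sum => c _; rewrite ger0_real ?mult_ge0.
  rewrite psumr_neq0 => [|c _]; last exact: mult_ge0.
  apply/hasP; exists b; first exact: grs_gwts.
  by rewrite Pb lt_def mult_ge0 andbT mult_eq0.
have : S (\sum_(c <- gwts | P c) (ev c z - ev b z) * mult c).
  elim/big_ind: _ => // c /asboolP cS; rewrite mulrC; apply: Sr cS.
  by rewrite ger0_real ?mult_ge0.
under eq_bigr do rewrite mulrBl.
rewrite sumrB tr0 -mulr_sumr sub0r => /SN; rewrite opprK mulrC.
set M := \sum_(c <- _ | _) _ in M0 Mreal *.
have Vreal : M^-1 \is Num.real by rewrite realV.
by move=> /(Sr _ _ Vreal); rewrite mulKf.
Qed.

(** If a(z) were not 0, then, after division by a(z)^2, the Killing square of z would be a sum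
    of nonnegative reals whose term for the weight a is positive. So a(z) = 0, and b(z) is a
    multiple of a(z). *)
Lemma killing0_ev0 a b x y : x \in grs a -> y \in grs (- a) -> grs b != 0%VS ->
  killing (bracket x y) (bracket x y) = 0 -> ev b (bracket x y) = 0.
Proof.
move=> xa ya b0 k0; set z := bracket x y in k0 *.
have zh : z \in h by have := bracket_grs xa ya; rewrite subrr (grs0 hh).
suff az : ev a z = 0.
  by have [r _ ->] := ev_bracket_real xa ya b0; rewrite az mulr0.
apply/eqP; apply: contraT => az.
have vE c : (ev c z / ev a z) ^+ 2 * mult c = ev c z ^+ 2 * mult c / ev a z ^+ 2.
  by rewrite expr_div_n mulrAC.
have sum0 : \sum_(c <- gwts) ((ev c z / ev a z) ^+ 2 * mult c : C) = 0.
  rewrite (eq_bigr _ (fun c _ => vE c)) -mulr_suml.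
  by rewrite -killing_cartan_square // k0 mul0r.
have ge0 c : 0 <= ((ev c z / ev a z) ^+ 2 * mult c : C).
  have [c0|c0] := eqVneq (grs c) 0%VS.
    suff -> : mult c = 0 by rewrite mulr0.
    by apply/eqP; rewrite mult_eq0 c0.
  rewrite mulr_ge0 ?mult_ge0 // -realEsqr.
  by have [r rr ->] := ev_bracket_real xa ya c0; rewrite -/z mulfK.
have [x0|x0] := eqVneq x 0.
  by case/eqP: az; rewrite /z x0 bracketC linear0 oppr0 /ev !linear0.
have agw : a \in gwts by exact: mem_gwts xa x0.
move: sum0 => /eqP; rewrite psumr_eq0 // => /allP/(_ a agw).
rewrite divff // expr1n mul1r mult_eq0 => /eqP a0.
by case/eqP: x0; apply/eqP; rewrite -memv0 -a0.
Qed.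

Hypothesis hg : lie_semisimple g.

(** The Cartan part of a perfect ideal on which the Killing form is isotropic
    is spanned by brackets of opposite root vectors, on which all the weights
    vanish; its homogeneous elements are then nilpotent. *)
Lemma killing_isotropic_ideal (I : {vspace g}) :
  lie_ideal I -> {in I, forall x, killing x x = 0} -> I = 0%VS.
Proof.
move=> idI kI; apply: contrapT => I0.
have nsolv : ~ lie_solvable I by move=> /(hg idI).
have [P [idP PI /eqP P0 PP]] := perfect_ideal idI nsolv.
have hP : {in h & P, forall x u, bracket x u \in P} by move=> x u _; exact: idP.
have P0ev x b : x \in P -> x \in h -> grs b != 0%VS -> ev b x = 0.
  move=> xP xh b0.
  have [L LE] : exists L : 'Hom(g, F^o), forall u, L u = ev b (gproj 0 u).
    by apply: (@linear_lfun _ g F^o) => k u v; rewrite linearP evD evZ.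
  have LP u : u \in P -> forall v, v \in P -> L (bracket u v) = 0.
    move=> uP v vP; apply/eqP.
    have -> : L (bracket u v) = (L \o ad u)%VF v by rewrite comp_lfunE adE.
    rewrite -memv_ker; move: v vP; apply/subvP/(grs_span hh) => // a v vP va.
    have e : (L \o ad u)%VF v = - (L \o ad v)%VF u.
      by rewrite !comp_lfunE !adE bracketC linearN.
    rewrite memv_ker e oppr_eq0 -memv_ker {e}.
    move: u uP; apply/subvP/(grs_span hh) => // c u uP uc.
    rewrite memv_ker comp_lfunE adE LE (gprojE hh _ (bracket_grs va uc)).
    have [ac|_] := eqVneq 0 (a + c); last by rewrite /ev !linear0.
    have cE : c = - a by apply/eqP; rewrite -addr_eq0 addrC -ac.
    apply/eqP/(killing0_ev0 va) => //; first by rewrite -cE.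
    by apply/kI/(subvP PI)/idP.
  have : L x = 0.
    apply/eqP; rewrite -memv_ker; move: x xP {xh}; apply/subvP; rewrite -PP.
    by apply/lie_prod_subP => u v uP vP; rewrite memv_ker LP.
  by rewrite LE (gprojE hh _ (_ : x \in grs 0)) ?eqxx // grs0.
(* Engel's theorem is applied to the homogeneous elements of P *)
pose W x := exists2 a : dualv h, x \in P & x \in grs a.
have WP x : W x -> x \in P by case.
have Pspan (X : {vspace g}) : (forall w, W w -> w \in X) -> (P <= X)%VS.
  by move=> WX; apply: (grs_span hh) => // a u uP ua; apply: WX; exists a.
have W_bracket x y : W x -> W y -> W (bracket x y).
  move=> [a xP xa] [b yP yb]; exists (a + b); first exact: idP.
  exact: bracket_grs.
have W_nil x v : W x -> v \in P -> gen_eigen (ad x) 0 v.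
  move=> [a xP xa] _; have [a0|a0] := eqVneq a 0; last first.
    have [_ hnil _] := hh.
    apply: (shift_nilpotent hnil (V := adjoint g) a0) => b u ub.
    by rewrite adE addrC; exact: bracket_grs.
  have xh : x \in h by rewrite -(grs0 hh) -a0.
  apply/pred_vspaceP; first exact: gen_eigen_lin.
  move: v; apply: (grs_spanT hh) => b u ub; apply/pred_vspaceP; first exact: gen_eigen_lin.
  have [->|u0] := eqVneq u 0; first exact: gen_eigen0.
  have b0 : grs b != 0%VS by apply: contraNneq u0 => b0; rewrite -memv0 -b0.
  by rewrite -(P0ev x b xP xh b0); exact: grs_ev.
have eP : forall U, (U <= P)%VS -> (forall w u, W w -> u \in U -> bracket w u \in U) ->
    U != P -> exists v, [/\ v \in P, v \notin U & forall w, W w -> bracket w v \in U].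
  by apply: engel => // w v _; exact: idP.
(* a maximal proper ideal of P contains [P, P] by Engel's theorem, so P is not perfect *)
pose Q (U : {vspace g}) := [/\ (U <= P)%VS, U != P &
  forall w u, W w -> u \in U -> bracket w u \in U].
have [|U [UP UnP WU] maxU] := @vspace_max _ _ Q 0%VS.
  split; rewrite ?sub0v //; first by rewrite eq_sym; apply/eqP.
  by move=> w u _; rewrite memv0 => /eqP ->; rewrite linear0 mem0v.
have [v [vP vU Wv]] := eP U UP WU UnP.
have WU1 w u : W w -> u \in (U + <[v]>)%VS -> bracket w u \in U.
  move=> Ww /memv_addP[u' u'U [_ /vlineP[c ->] ->]].
  by rewrite linearD linearZ memvD ?WU ?memvZ ?Wv.
have U1P : (U + <[v]>)%VS = P.
  apply: contrapT => /eqP nP; case/negP: vU.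
  suff /maxU dU : Q (U + <[v]>)%VS.
    have /eqP -> : U == (U + <[v]>)%VS by rewrite eqEdim addvSl.
    by rewrite (subvP (addvSr _ _)) ?memv_line.
  split=> //; first by rewrite subv_add UP; apply/subvP => _ /vlineP[c ->]; rewrite memvZ.
  by move=> w u Ww uU1; rewrite (subvP (addvSl _ _)) // WU1.
case/negP: UnP; rewrite eqEsubv UP -{1}PP; apply/lie_prod_subP => x y xP yP.
rewrite -[bracket x y]/(bracketr y x) -lfunE memv_preim.
move: x xP; apply/subvP/Pspan => w Ww; rewrite -memv_preim lfunE.
by apply: WU1; rewrite ?U1P.
Qed.

Lemma killing_nondegenerate x : (forall y, killing x y = 0) -> x = 0.
Proof.
move=> xk; apply/eqP; rewrite -memv0.
rewrite -(@killing_isotropic_ideal (killing_orthogonal {:g})).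
- by apply/killing_orthogonalP => y _.
- by apply: killing_orthogonal_ideal => z y _; exact: memvf.
- by move=> y /killing_orthogonalP; apply; exact: memvf.
Qed.

End Criterion.

(** * Root spaces of a semisimple Lie algebra *)

Section RootStructure.
Variable (C : numClosedFieldType).
Let F : fieldType := C.
Variables (g : lieAlgType F) (h : {vspace g}).
Hypotheses (hh : cartan_subalg h) (hg : lie_semisimple g).
Implicit Types (a b c : dualv h) (x y z u v w e f : g).
Local Notation gproj := (gproj hh).
Local Notation gwts := (gwts hh).
Local Notation mult := (mult hh).

Let hnil : lie_nilpotent h. Proof. by case: hh. Qed.

Lemma killing_grs a b x y : x \in grs a -> y \in grs b -> a + b != 0 -> killing x y = 0.
Proof.
move=> xa yb ab0; apply: (lftrace_shift hh (V := adjoint g) ab0) => c v vc.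
by rewrite comp_lfunE !adE addrC -addrA; do 2!apply: bracket_grs => //.
Qed.

Lemma killing_ext x : (forall a y, y \in grs a -> killing x y = 0) -> x = 0.
Proof.
move=> xk; apply: (killing_nondegenerate hh hg) => y; rewrite killingC.
suff /killing_orthogonalP : y \in killing_orthogonal <[x]> by apply; exact: memv_line.
move: y; apply: (grs_spanT hh) => a y ya; apply/killing_orthogonalP => _ /vlineP[k ->].
by rewrite killingZr killingC (xk a) ?mulr0.
Qed.

(** x is orthogonal to h by the trace formula, and to the root spaces by killing_grs. *)
Lemma cartan_eq0 x : x \in h -> (forall b, grs b != 0%VS -> ev b x = 0) -> x = 0.
Proof.
move=> xh x0; apply: killing_ext => b y yb; have [b0|b0] := eqVneq b 0; last first.
  by apply: (@killing_grs 0 b) => //; rewrite ?add0r // (grs0 hh).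
have yh : y \in h by rewrite -(grs0 hh) -b0.
rewrite (killing_cartan hh xh yh) big1 // => c _.
have [c0|c0] := eqVneq (grs c) 0%VS; last by rewrite x0 ?mul0r.
suff -> : mult c = 0 by rewrite mulr0.
by apply/eqP; rewrite mult_eq0 c0.
Qed.

(** A weight is, on [x, y], a real multiple of the weight 0. *)
Lemma cartan_abelian x y : x \in h -> y \in h -> bracket x y = 0.
Proof.
move=> xh yh; apply: cartan_eq0 => [|b b0]; first by have [+ _ _] := hh; apply.
have [||r _ ->] := @ev_bracket_real C g h hh 0 b x y _ _ b0; rewrite ?oppr0 ?grs0 //.
by rewrite /ev lfunE mulr0.
Qed.

(** The nilpotent part E of ad x is a derivation, so ad (E u) = [E, ad u] and the Killing
    product of E u and w is tr (E ad [u, w]). This is 0: either E ad [u, w] shifts weights,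
    or [u, w] is in h and commutes with the nilpotent E. So E = 0. *)
Lemma cartan_bracket a x y : x \in h -> y \in grs a -> bracket x y = ev a x *: y.
Proof.
move=> xh ya.
have [E EE] : exists E : 'End(g), forall b v, v \in grs b -> E v = bracket x v - ev b x *: v.
  exists (ad x - weight_scaling hh (fun a => ev a x))%VF => b v vb.
  by rewrite add_lfunE opp_lfunE (weight_scalingE _ _ vb) adE.
have Est b v : v \in grs b -> E v \in grs b.
  move=> vb; rewrite (EE _ _ vb) memvB ?memvZ // -[b]add0r.
  by apply: bracket_grs; rewrite ?grs0.
have Eder c u : u \in grs c -> ad (E u) = ((E \o ad u) - (ad u \o E))%VF.
  move=> uc; apply: (eq_on_grs hh) => b v vb; rewrite add_lfunE opp_lfunE !comp_lfunE !adE.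
  rewrite (EE _ _ (bracket_grs uc vb)) (EE _ _ vb) (EE _ _ uc) (bracketA x).
  rewrite bracketDl bracketNl bracketZl (linearB (bracket u)) (linearZ_LR (bracket u)) /=.
  rewrite ev_add scalerDl.
  by rewrite opprD addrACA addrK.
have [n En] : exists n, forall v, iter n E v = 0.
  have E0 v : gen_eigen E 0 v.
    apply/pred_vspaceP; first exact: gen_eigen_lin.
    move: v; apply: (grs_spanT hh) => b v vb; apply/pred_vspaceP; first exact: gen_eigen_lin.
    have [n vn] := grs_ev xh vb; apply: (@gen_eigen_nilp _ _ _ n); rewrite -[RHS]vn.
    have st m : iter m E v = iter m (subscalar (ad x) (ev b x)) v /\ iter m E v \in grs b.
      elim: m => [//|m [IHm IHb]]; split; last by rewrite iterS Est.
      by rewrite !iterS -IHm (EE _ _ IHb) subscalarE adE.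
    by case: (st n).
  have [n En] := gen_eigen_nilpotent_unif E0; exists n => v.
  by rewrite -[RHS](En v) subscalar0.
have trE c z : z \in grs c -> lftrace (E \o ad z)%VF = 0.
  move=> zc; have [c0|c0] := eqVneq c 0; last first.
    apply: (lftrace_shift hh (V := adjoint g) c0) => b v vb.
    by rewrite comp_lfunE adE addrC Est // bracket_grs.
  have zh : z \in h by rewrite -(grs0 hh) -c0.
  apply: (lftrace_nilpotent (k := n)) => v; rewrite iter_comp_comm ?En // => u.
  have Ez : E z = 0.
    by rewrite (EE _ _ zc) c0 /ev lfunE scale0r subr0 cartan_abelian.
  have := Eder _ _ zc; rewrite Ez linear0 => /esym/eqP; rewrite subr_eq0 => /eqP/lfunP/(_ u).
  by rewrite !comp_lfunE.
suff : E y = 0 by rewrite (EE _ _ ya) => /eqP; rewrite subr_eq0 => /eqP.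
apply: killing_ext => c w wc; rewrite /killing (Eder _ _ ya) comp_lfunDl comp_lfunNl lftraceB.
rewrite -!comp_lfunA [lftrace (ad y \o _)%VF]lftraceC -comp_lfunA.
rewrite -lftraceB -comp_lfunNr -comp_lfunDr.
by rewrite -ad_bracket (trE (a + c)) ?bracket_grs.
Qed.

End RootStructure.

(** * Representations of sl(2) *)

Section Sl2.
Variable (C : numClosedFieldType).
Let F : fieldType := C.
Variables (g : lieAlgType F) (V : lieModule g) (e f z : g).
Hypotheses (ef : bracket e f = z) (ze : bracket z e = 2%:R *: e)
  (zf : bracket z f = - (2%:R *: f)).
Hypothesis f_nil : forall v : V, gen_eigen (lmod_action V f) 0 v.
Local Notation "x .: v" := (lmod_action V x v) (at level 40, left associativity).

Let actNl x (v : V) : (- x) .: v = - (x .: v).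
Proof. by rewrite (linearN (lmod_action V)) opp_lfunE. Qed.

Let actZl k x (v : V) : (k *: x) .: v = k *: (x .: v).
Proof. by rewrite (linearZ_LR (lmod_action V)) scale_lfunE. Qed.

Let actZr k x (v : V) : x .: (k *: v) = k *: (x .: v).
Proof. exact: linearZ_LR. Qed.

Let actNr x (v : V) : x .: (- v) = - (x .: v).
Proof. exact: linearN. Qed.

Let act0r x : x .: (0 : V) = 0.
Proof. exact: linear0. Qed.

Lemma action_zf (m : F) (v : V) : z .: v = m *: v -> z .: (f .: v) = (m - 2%:R) *: (f .: v).
Proof.
move=> zv; rewrite lmod_actionA zf zv actNl actZl actZr.
by rewrite scalerBl addrC.
Qed.

Lemma iter_f_weight (m : F) (v : V) k : z .: v = m *: v ->
  z .: iter k (lmod_action V f) v = (m - k.*2%:R) *: iter k (lmod_action V f) v.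
Proof.
move=> zv; elim: k => [|k IHk]; first by rewrite subr0.
by rewrite iterS (action_zf IHk) -addrA -opprD -natrD addn2.
Qed.

(** Move e to the right through k + 1 factors f, using ef and iter_f_weight. *)
Lemma e_iter_f (m : F) (v : V) k : e .: v = 0 -> z .: v = m *: v ->
  e .: iter k.+1 (lmod_action V f) v
  = (k.+1%:R * (m - k%:R)) *: iter k (lmod_action V f) v.
Proof.
move=> ev0 zv; elim: k => [|k IHk].
  by rewrite /= lmod_actionA ef zv ev0 act0r addr0 subr0 mul1r.
rewrite iterS lmod_actionA IHk ef (iter_f_weight _ zv) actZr -scalerDl.
by congr (_ *: _); rewrite -addnn -!(addn1 k) -(addn1 (k + 1)) !natrD; ring.
Qed.

(** By e_iter_f, the string of the f^k v can end at f^n v only if m = n; it ends because f is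
    nilpotent. *)
Lemma primitive_weight (m : F) (v : V) : e .: v = 0 -> z .: v = m *: v -> v != 0 ->
  exists n : nat, m = n%:R.
Proof.
move=> ev0 zv v0; have [n] := f_nil v; rewrite subscalar0.
elim: n => [/= v00|n IHn fn]; first by rewrite v00 eqxx in v0.
have [/IHn //|fn0] := eqVneq (iter n (lmod_action V f) v) 0.
have := e_iter_f n ev0 zv; rewrite fn act0r => /esym/eqP.
rewrite scaler_eq0 (negPf fn0) orbF mulf_eq0 pnatr_eq0 subr_eq0 => /eqP ->.
by exists n.
Qed.

Lemma primitive_string (n : nat) (v : V) k : e .: v = 0 -> z .: v = n%:R *: v -> v != 0 ->
  (k <= n)%N -> iter k (lmod_action V f) v != 0.
Proof.
move=> ev0 zv v0; elim: k => [//|k IHk] lt_kn; apply/eqP => fk.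
have := e_iter_f k ev0 zv; rewrite fk act0r => /esym/eqP.
rewrite scaler_eq0 mulf_eq0 pnatr_eq0 -natrB ?(ltnW lt_kn) // pnatr_eq0 subn_eq0.
by rewrite leqNgt lt_kn (negPf (IHk (ltnW lt_kn))).
Qed.

(** By induction on the exponent that kills v, z v has weight 0 and is killed by f. Then
    e f^(k+1) v is a nonzero multiple of f^k v for k > 0, so f v = 0, and z v = e f v. *)
Lemma primitive_weight0 (v : V) : e .: v = 0 -> gen_eigen (lmod_action V z) 0 v ->
  f .: v = 0 /\ z .: v = 0.
Proof.
move=> + [n]; rewrite subscalar0; elim: n v => [|n IHn] v ev0.
  by move=> /= ->; rewrite !act0r.
rewrite iterSr => zn; have ezv : e .: (z .: v) = 0.
  by rewrite lmod_actionA ev0 act0r addr0 bracketC actNl ze actZl ev0 scaler0 oppr0.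
have [fzv zzv] := IHn _ ezv zn.
have zf_ k : z .: iter k.+1 (lmod_action V f) v
    = - (k.+1.*2%:R *: iter k.+1 (lmod_action V f) v).
  elim: k => [|k IHk].
    by rewrite /= lmod_actionA zf fzv addr0 actNl actZl.
  rewrite iterS (action_zf (m := - k.+1.*2%:R)) ?scaleNr // -opprD scaleNr -natrD.
  by rewrite addn2.
have ef_ k : e .: iter k.+2 (lmod_action V f) v
    = - ((k.+1 * k.+2)%:R *: iter k.+1 (lmod_action V f) v).
  elim: k => [|k IHk].
    rewrite iterS lmod_actionA ef zf_ /= (lmod_actionA e f) ev0 act0r addr0 ef fzv addr0.
    by [].
  rewrite iterS lmod_actionA ef zf_ IHk actNr actZr -opprD -scalerDl -natrD.
  by congr (- (_%:R *: _)); rewrite -muln2 (mulnC k.+1) -mulnDr.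
have f0 : f .: v = 0.
  have [k] := f_nil v; rewrite subscalar0; elim: k => [/= ->|k IHk]; first by rewrite act0r.
  case: k IHk => [//|k] IHk fk; apply: IHk; apply/eqP.
  have /eqP := ef_ k; rewrite fk act0r eq_sym oppr_eq0 scaler_eq0 pnatr_eq0.
  by rewrite muln_eq0.
by split=> //; rewrite -ef -[RHS](act0r e) -f0 lmod_actionA ev0 act0r addr0.
Qed.

End Sl2.

(** * The root system *)

Section Roots.
Variable (C : numClosedFieldType).
Let F : fieldType := C.
Variables (g : lieAlgType F) (h : {vspace g}).
Hypotheses (hh : cartan_subalg h) (hg : lie_semisimple g).
Implicit Types (a b c : dualv h) (x y z u v w e f : g).

Let hnil : lie_nilpotent h. Proof. by case: hh. Qed.

(** The generalized root spaces of h are eigenspaces, by cartan_bracket. *)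
Lemma root_space_eq a : root_space a = grs a.
Proof.
apply/eqP; rewrite eqEsubv root_space_grs; apply/subvP => y ya.
apply/root_spaceP => x; rewrite (cartan_bracket hh hg (subvsP x) ya).
by rewrite (evE _ (subvsP x)); congr (a _ *: _); apply: val_inj.
Qed.

Lemma root_systemP a : root_system h a <-> a != 0 /\ grs a != 0%VS.
Proof. by rewrite /root_system /= root_space_eq; split=> -[/eqP ? /eqP]. Qed.

Lemma opposite_bracket a e f : e \in grs a -> f \in grs (- a) -> bracket e f \in h.
Proof. by move=> ea fa; have := bracket_grs ea fa; rewrite subrr (grs0 hh). Qed.

Lemma killing_opposite_bracket a e f w : e \in grs a -> f \in grs (- a) -> w \in h ->
  killing (bracket e f) w = ev a w * killing e f.
Proof.
move=> ea fa wh; rewrite killing_invariant bracketC (cartan_bracket hh hg wh fa).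
by rewrite ev_opp scaleNr opprK killingZr.
Qed.

Lemma opposite_bracket_eq0 a e f : e \in grs a -> f \in grs (- a) ->
  killing e f = 0 -> bracket e f = 0.
Proof.
move=> ea fa k0; apply: (killing_ext hh hg) => b w wb; have [b0|b0] := eqVneq b 0.
  by rewrite (killing_opposite_bracket ea fa) ?k0 ?mulr0 // -(grs0 hh) -b0.
have z0 : bracket e f \in grs (0 : dualv h) by rewrite (grs0 hh) (opposite_bracket ea fa).
by apply: (killing_grs hh z0 wb); rewrite add0r.
Qed.

Lemma killing_pairing a f : f \in grs (- a) -> f != 0 -> exists2 e, e \in grs a & killing e f != 0.
Proof.
move=> fa f0; apply: contrapT => ne; case/eqP: f0; apply: (killing_ext hh hg) => b y yb.
have [ba|ba] := eqVneq b a.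
  rewrite killingC; apply/eqP; apply: contrapT => /negP k0; apply: ne.
  by exists y; rewrite -?ba.
by rewrite (killing_grs hh fa yb) // addrC subr_eq0.
Qed.

(** Take e with nonzero Killing product with f, and rescale it. If a([e, f]) were 0, all the
    weights would vanish on [e, f] by ev_bracket_real, so [e, f] would be 0. *)
Lemma sl2_triple a f : a != 0 -> f \in grs (- a) -> f != 0 ->
  exists2 e, e \in grs a & ev a (bracket e f) = 2%:R.
Proof.
move=> a0 fa f0; have [e ea k0] := killing_pairing fa f0.
have zh := opposite_bracket ea fa; set z := bracket e f in zh.
have az : ev a z != 0.
  apply: contraTneq isT => az.
  have z0 : z = 0.
    apply: (cartan_eq0 hh hg zh) => b b0.
    by have [r _ ->] := ev_bracket_real hh ea fa b0; rewrite -/z az mulr0.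
  have [w wh aw] := ev_neq0 a0; have := killing_opposite_bracket ea fa wh.
  rewrite -/z z0 killingC killing0r => /esym/eqP.
  by rewrite mulf_eq0 (negPf aw) (negPf k0).
pose k : F := 2%:R / ev a z.
exists (k *: e); first exact: memvZ.
by rewrite bracketZl evZ -/z /k divfK.
Qed.

Lemma sl2_triple_brackets a e f (z := bracket e f) : e \in grs a -> f \in grs (- a) ->
    ev a z = 2%:R ->
  [/\ z \in h, bracket z e = 2%:R *: e & bracket z f = - (2%:R *: f)].
Proof.
move=> ea fa az; have zh := opposite_bracket ea fa; split=> //.
  by rewrite (cartan_bracket hh hg zh ea) az.
by rewrite (cartan_bracket hh hg zh fa) ev_opp az scaleNr.
Qed.

Lemma root_vector_nilpotent (V : lieModule g) a f : a != 0 -> f \in grs a ->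
  forall v : V, gen_eigen (lmod_action V f) 0 v.
Proof.
move=> a0 fa; apply: (shift_nilpotent hnil a0) => b v vb.
exact: (@gwt_action C g h V a b f v fa vb).
Qed.

Lemma grs_opp a : grs a != 0%VS -> grs (- a) != 0%VS.
Proof.
move=> a0; apply: contraNneq a0 => Na0; rewrite -subv0; apply/subvP => f fa.
rewrite memv0; apply: contraT => f0.
have [e] : exists2 e, e \in grs (- a) & killing e f != 0.
  by apply: killing_pairing; rewrite ?opprK.
by rewrite Na0 memv0 => /eqP ->; rewrite killingC killing0r eqxx.
Qed.

(** If the root space were larger, it would contain a vector u orthogonal to e;
    u would be primitive of weight -2 for the triple of e and x. *)
Lemma root_space_line a x y : a != 0 -> x \in grs a -> x != 0 -> y \in grs a ->
  exists k, y = k *: x.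
Proof.
move=> a0 xa x0 ya; have Na0 : - a != 0 by rewrite oppr_eq0.
have xNa : x \in grs (- - a) by rewrite opprK.
have [e ea az] := sl2_triple Na0 xNa x0; set z := bracket e x in az.
have [zh ze zx] := sl2_triple_brackets ea xNa az.
have kex : killing e x != 0.
  apply: contraTneq isT => k0; move/eqP: az.
  by rewrite /z (opposite_bracket_eq0 ea xNa k0) /ev !linear0 eq_sym pnatr_eq0.
pose k := killing e y / killing e x; exists k; apply/eqP; rewrite -subr_eq0.
set u := y - k *: x; have ua : u \in grs a by rewrite memvB ?memvZ.
have uNa : u \in grs (- - a) by rewrite opprK.
have eu : bracket e u = 0.
  apply: (opposite_bracket_eq0 ea uNa).
  by rewrite /u -scaleNr killingDr killingZr mulNr divfK ?subrr.
apply: contraT => u0.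
have [||||n /eqP] := @primitive_weight C g (adjoint g) e x z erefl zx _ (- 2%:R) u.
- by move=> v; apply: (@root_vector_nilpotent (adjoint g) a).
- by rewrite adjointE.
- by rewrite adjointE (cartan_bracket hh hg zh ua) -[a]opprK ev_opp az.
- exact: u0.
- by rewrite eq_sym -subr_eq0 opprK -natrD pnatr_eq0 addn2.
Qed.

(** Let e, f be root vectors for a and -a. If e killed the root space of b, it
    would consist of primitive vectors, so b would be dominant for the triple;
    but going down from the top of the a-string through a + b, one reaches in the
    root space of b a vector that e does not kill. *)
Lemma bracket_root_spaces a b w : a != 0 -> b != 0 -> a + b != 0 ->
    grs a != 0%VS -> grs b != 0%VS -> w \in grs (a + b) ->
  exists e u, [/\ e \in grs a, u \in grs b & w = bracket e u].
Proof.
move=> a0 b0 ab0 ga gb wab.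
have [->|w0] := eqVneq w 0; first by exists 0, 0; rewrite !mem0v linear0.
have [f fa f0] : exists2 f, f \in grs (- a) & f != 0.
  by exists (vpick (grs (- a))); rewrite ?memv_pick // vpick0 grs_opp.
have [e ea az] := sl2_triple a0 fa f0.
have [zh ze zf] := sl2_triple_brackets ea fa az; set z := bracket e f in zh ze zf az.
have Na0 : - a != 0 by rewrite oppr_eq0.
have f_nil (v : adjoint g) := @root_vector_nilpotent (adjoint g) _ _ Na0 fa v.
suff [u ub eu0] : exists2 u, u \in grs b & bracket e u != 0.
  have [k wE] := root_space_line ab0 (bracket_grs ea ub) eu0 wab.
  by exists e, (k *: u); rewrite memvZ // linearZ.
apply: contrapT => nu.
have eb u : u \in grs b -> bracket e u = 0.
  by move=> ub; apply/eqP; apply: contrapT => /negP eu; apply: nu; exists u.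
have [m mE] : exists m : nat, ev b z = m%:R.
  apply: (@primitive_weight C g (adjoint g) e f z erefl zf f_nil _ (vpick (grs b))).
  - by rewrite adjointE eb ?memv_pick.
  - by rewrite adjointE (cartan_bracket hh hg zh (memv_pick _)).
  - by rewrite vpick0.
have [j wj0 ewj] : exists2 j, iter j (ad e) w != 0 & iter j.+1 (ad e) w = 0.
  have [n] := @root_vector_nilpotent (adjoint g) _ _ a0 ea w; rewrite subscalar0 lmod_adjoint.
  elim: n => [/= w00|n IHn]; first by rewrite w00 eqxx in w0.
  by have [/IHn //|] := eqVneq (iter n (ad e) w) 0; exists n.
have wjE : iter j (ad e) w \in grs (a + b + a *+ j).
  elim: j {wj0 ewj} => [|j IHj]; first by rewrite addr0.
  by rewrite iterS adE mulrSr addrA [X in grs X]addrC bracket_grs.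
set wj := iter j (ad e) w in wj0 wjE ewj.
have ewj0 : lmod_action (adjoint g) e wj = 0 by rewrite lmod_adjoint.
have zwj : lmod_action (adjoint g) z wj = (j.*2 + m.+2)%:R *: wj.
  rewrite adjointE (cartan_bracket hh hg zh wjE) !ev_add mE az.
  have -> : ev (a *+ j) z = (j.*2)%:R.
    by rewrite ev_mulrn az -mulrnA mul2n.
  by rewrite -!natrD; congr (_%:R *: _); rewrite addnC add2n.
have fkE k : iter k (lmod_action (adjoint g) f) wj \in grs (a + b + a *+ j - a *+ k).
  elim: k => [|k IHk]; first by rewrite subr0.
  by rewrite iterS adjointE mulrSr opprD addrA [X in grs X]addrC bracket_grs.
have : bracket e (iter j.+1 (lmod_action (adjoint g) f) wj) = 0.
  by apply: eb; have := fkE j.+1; rewrite mulrSr opprD addrA addrK [X in grs X]addrC addKr.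
rewrite -adjointE (e_iter_f (z := z) erefl zf _ ewj0 zwj) => /eqP.
have lt_jp : (j < j.*2 + m.+2)%N by rewrite -addnn -addnA -[X in (X < _)%N]addn0 ltn_add2l addnS.
apply/negP; rewrite scaler_eq0 !mulf_eq0 pnatr_eq0 subr_eq0 eqr_nat (gtn_eqF lt_jp) /=.
exact: (primitive_string (z := z) erefl zf ewj0 zwj wj0 (ltnW lt_jp)).
Qed.

(** The Killing form would otherwise provide a nonzero y orthogonal to X, hence to
    all root vectors and to all their brackets, so that y would lie in the Cartan
    subalgebra and be killed by all roots. *)
Lemma root_generation (X : {vspace g}) : lie_subalg X ->
  (forall a, root_system h a -> (root_space a <= X)%VS) -> X = {:g}%VS.
Proof.
move=> Xsub Xroot; have Xgrs a : a != 0 -> (grs a <= X)%VS.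
  move=> a0; have [->|ga] := eqVneq (grs a) 0%VS; first exact: sub0v.
  by rewrite -root_space_eq; apply/Xroot/root_systemP.
apply: contrapT => XnT.
have [v vX] : exists v, v \notin X.
  apply: contrapT => /forallNP nv; apply: XnT; apply/vspaceP => v; rewrite memvf.
  by apply: contrapT => /negP /nv.
have [L LX Lv] : exists2 L : 'Hom(g, F^o), {in X, forall u, L u = 0} & L v != 0.
  have [i vi] : exists i, coord (vbasis {:g}) i (v - projv X v) != 0.
    apply: contrapT => /forallNP ni; case/negP: vX.
    rewrite -[v](subrK (projv X v)) (coord_vbasis (memvf (v - _))) big1 ?add0r ?memv_proj //.
    by move=> i _; have /negP := ni i; rewrite negbK => /eqP ->; rewrite scale0r.
  have [L LE] : exists L : 'Hom(g, F^o), forall u, L u = coord (vbasis {:g}) i (u - projv X u).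
    apply: (@linear_lfun _ g F^o) => k u u'.
    by rewrite (linearP (projv X)) opprD addrACA -scalerBr linearP.
  by exists L; rewrite ?LE // => u uX; rewrite LE projv_id // subrr linear0.
have [K KE] : exists K : 'Hom(g, 'Hom(g, F^o)), forall x y, K x y = killing x y.
  have /choice[Kf KfE] x : exists Kx : 'Hom(g, F^o), forall y, Kx y = killing x y.
    exact: (linear_lfun (killing_linear x)).
  have [|K KE] := @linear_lfun _ g 'Hom(g, F^o) Kf.
    move=> k x y; apply/lfunP => u; rewrite add_lfunE scale_lfunE !KfE.
    by rewrite killingDl killingZl.
  by exists K => x y; rewrite KE KfE.
have K0 : lker K = 0%VS.
  apply/eqP; rewrite -subv0; apply/subvP => x; rewrite memv_ker memv0 => /eqP Kx.
  by apply/eqP/(killing_nondegenerate hh hg) => y; rewrite -KE Kx lfunE.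
have /memv_imgP[y _ LE] : L \in limg K.
  suff -> : limg K = fullv by exact: memvf.
  apply/eqP; rewrite eqEdim subvf limg_dim_eq ?K0 ?capv0 // !dimvf.
  by rewrite /dim /= muln1.
have yX u : u \in X -> killing y u = 0 by rewrite -KE -LE; exact: LX.
have py a : a != 0 -> gproj hh a y = 0.
  move=> a0; apply: (killing_ext hh hg) => b u ub.
  have [ba|ba] := eqVneq (a + b) 0; last by apply: (killing_grs hh _ ub ba); exact: gproj_mem.
  have b0 : b != 0 by apply: contraNneq a0 => b0; rewrite -ba b0 addr0.
  have Ku : (K u \o gproj hh a)%VF = K u.
    apply: (eq_on_grs hh) => c v' v'c; rewrite comp_lfunE (gprojE hh _ v'c).
    have [//|ac] := eqVneq a c; rewrite linear0 KE (killing_grs hh ub v'c) //.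
    apply: contraNneq ac => bc; rewrite -subr_eq0.
    have -> : c = a by apply: (addIr b); rewrite ba addrC.
    by rewrite subrr.
  have := yX u (subvP (Xgrs b b0) _ ub).
  by rewrite killingC -KE -Ku comp_lfunE KE killingC.
have yh : y \in h.
  rewrite -(gproj_sum hh y); apply: memv_suml => a _; have [->|a0] := eqVneq a 0.
    by have := gproj_mem hh 0 y; rewrite (grs0 hh).
  by rewrite py ?mem0v.
case/eqP: Lv; rewrite LE; suff -> : y = 0 by rewrite !linear0 lfunE.
apply: (cartan_eq0 hh hg yh) => b gb; have [->|b0] := eqVneq b 0; first by rewrite /ev lfunE.
have [f fb f0] : exists2 f, f \in grs (- b) & f != 0.
  by exists (vpick (grs (- b))); rewrite ?memv_pick // vpick0 grs_opp.
have [e eb k0] := killing_pairing fb f0.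
have Nb0 : - b != 0 by rewrite oppr_eq0.
have /yX : bracket e f \in X.
  by apply: Xsub; [apply: (subvP (Xgrs b b0))|apply: (subvP (Xgrs _ Nb0))].
rewrite killingC (killing_opposite_bracket eb fb yh) => /eqP.
by rewrite mulf_eq0 (negPf k0) orbF => /eqP.
Qed.

End Roots.

(** * Endomorphism modules *)

Section Endo.
Variables (F : fieldType) (g : lieAlgType F) (M : lieModule g).

Lemma endo_action_exists : exists A : 'Hom(g, 'End('End(M))), forall x (f : 'End(M)),
  A x f = ((lmod_action M x \o f) - (f \o lmod_action M x))%VF.
Proof.
have /choice[A AE] x : exists Ax : 'End('End(M)), forall f : 'End(M),
    Ax f = ((lmod_action M x \o f) - (f \o lmod_action M x))%VF.
  apply: linear_lfun => k u v.
  by rewrite comp_lfunDr comp_lfunDl -comp_lfunZr -comp_lfunZl opprD addrACA scalerBr.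
have [|B BE] := @linear_lfun _ g 'End('End(M)) A; last by exists B => x f; rewrite BE AE.
move=> k x y; apply/lfunP => f; rewrite add_lfunE scale_lfunE !AE linearP.
by rewrite comp_lfunDr comp_lfunDl -comp_lfunZr -comp_lfunZl opprD addrACA scalerBr.
Qed.

Definition endo_action : 'Hom(g, 'End('End(M))) := projT1 (cid endo_action_exists).

Lemma endo_actionE x (f : 'End(M)) :
  endo_action x f = ((lmod_action M x \o f) - (f \o lmod_action M x))%VF.
Proof. by rewrite /endo_action; case: cid. Qed.

Lemma endo_actionEv x (f : 'End(M)) v :
  endo_action x f v = lmod_action M x (f v) - f (lmod_action M x v).
Proof. by rewrite endo_actionE add_lfunE opp_lfunE !comp_lfunE. Qed.

Lemma endo_action_bracket x y (f : 'End(M)) : endo_action (bracket x y) f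
  = endo_action x (endo_action y f) - endo_action y (endo_action x f).
Proof.
have alg (a b c d p q : M) : a - b - (c - d) = (a - p - (q - d)) - (b - q - (p - c)).
  have subB (x' y' z' t' : M) : x' - y' - (z' - t') = (x' + t') - (y' + z').
    by rewrite opprB addrACA -opprD.
  rewrite (subB a b) (subB a p) (subB b q) (subB (a + d)) [q + p]addrC.
  by rewrite (addrC (p + q)) (opprD (b + c) (p + q)) (addrACA (a + d)) subrr addr0.
apply/lfunP => v; rewrite add_lfunE opp_lfunE !endo_actionEv !lmod_action_bracket.
rewrite (linearB f) (linearB (lmod_action M x)) (linearB (lmod_action M y)).
exact: alg.
Qed.

Definition endo : lieModule g := LieModule endo_action_bracket.

Lemma endoE x (f : endo) : lmod_action endo x f
  = ((lmod_action M x \o (f : 'End(M))) - ((f : 'End(M)) \o lmod_action M x))%VF.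
Proof. exact: endo_actionE. Qed.

Lemma endo_comp x (f f' : 'End(M)) : lmod_action endo x (f \o f')%VF
  = (((lmod_action endo x f : 'End(M)) \o f') + (f \o (lmod_action endo x f' : 'End(M))))%VF.
Proof.
rewrite !endoE comp_lfunDl comp_lfunNl comp_lfunDr comp_lfunNr -!comp_lfunA.
by rewrite addrA subrK.
Qed.

Lemma endo1 x : lmod_action endo x (\1%VF : 'End(M)) = 0.
Proof. by rewrite endoE comp_lfun1l comp_lfun1r subrr. Qed.

Lemma endo_eq0P x (f : 'End(M)) : lmod_action endo x f = 0 <->
  (forall v, lmod_action M x (f v) = f (lmod_action M x v)).
Proof.
rewrite endoE; split=> [/lfunP xf v|xf].
  by have /eqP := xf v; rewrite add_lfunE opp_lfunE !comp_lfunE lfunE subr_eq0 => /eqP.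
by apply/lfunP => v; rewrite add_lfunE opp_lfunE !comp_lfunE lfunE /= xf subrr.
Qed.

End Endo.

Section Schur.
Variable (C : numClosedFieldType).
Let F : fieldType := C.
Variables (g : lieAlgType F) (M : lieModule g).
Hypothesis simpleM : simple_module M.

(** An eigenspace of f is a submodule. *)
Lemma schur (f : 'End(M)) : (forall x, lmod_action (endo M) x f = 0) ->
  exists c : F, f = c *: \1%VF.
Proof.
move=> xf; have [M0 Msub] := simpleM.
have [|c [v [_ v0 fv]]] := @eigenvector_in C M f fullv (fun u _ => memvf (f u)).
  by apply/eqP.
exists c; pose U := lker (f - c *: \1)%VF.
have UP u : (u \in U) = (f u == c *: u) by rewrite memv_ker -/(subscalar f c) subscalarE subr_eq0.
have [|U0|UT] := Msub U.
- move=> x u _; rewrite !UP => /eqP fu.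
  by have /endo_eq0P <- := xf x; rewrite fu linearZ.
- by case/eqP: v0; apply/eqP; rewrite -memv0 -U0 UP fv.
- apply/lfunP => u; rewrite scale_lfunE id_lfunE; apply/eqP.
  by rewrite -UP UT memvf.
Qed.

End Schur.

(** * Sufficiency *)

Section Sufficiency.
Variable (C : numClosedFieldType).
Let F : fieldType := C.
Variables (g : lieAlgType F) (h : {vspace g}).
Hypotheses (hh : cartan_subalg h) (hg : lie_semisimple g).
Variable T : set (dualv h).
Hypotheses (Troot : T `<=` root_system h)
  (Tgen : root_system h `<=` closed_hull (T `|` opp_roots T)).
Variable M : lieModule g.
Hypothesis simpleM : simple_module M.
Implicit Types (a b : dualv h) (f : 'End(M)).

Let hnil : lie_nilpotent h. Proof. by case: hh. Qed.

Definition centralizer : {vspace endo M} :=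
  pred_vspace (fun f => forall a y, T a -> y \in grs a -> lmod_action (endo M) y f = 0).

Lemma centralizerP (f : endo M) :
  reflect (forall a y, T a -> y \in grs a -> lmod_action (endo M) y f = 0) (f \in centralizer).
Proof.
apply: pred_vspaceP; split=> [a y _ _|k u v uc vc a y Ta ya]; first exact: linear0.
by rewrite (lmod_action_linr y k u v) (uc a) ?(vc a) // scaler0 addr0.
Qed.

Lemma centralizer_stable : submodule h centralizer.
Proof.
move=> x f xh /centralizerP fc; apply/centralizerP => a y Ta ya.
rewrite lmod_actionA (fc a y) // linear0 addr0 bracketC (cartan_bracket hh hg xh ya).
rewrite -scaleNr (linearZ_LR (lmod_action (endo M))) scale_lfunE (fc a y) //.
by rewrite scaler0.
Qed.

Lemma centralizer_comp f f' : f \in centralizer -> f' \in centralizer ->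
  (f \o f')%VF \in centralizer.
Proof.
move=> /centralizerP fc /centralizerP fc'; apply/centralizerP => a y Ta ya.
by rewrite endo_comp (fc a) ?(fc' a) // comp_lfun0l comp_lfun0r addr0.
Qed.

Lemma gwt_comp a b f f' : f \in gwt (endo M) a -> f' \in gwt (endo M) b ->
  (f \o f')%VF \in gwt (endo M) (a + b).
Proof.
apply: (gwt_bilinear (B := fun f f' : endo M => (f \o f')%VF : endo M)).
- by move=> f2 k u v; rewrite comp_lfunDl comp_lfunZl.
- by move=> f1 k u v; rewrite comp_lfunDr comp_lfunZr.
- by move=> x u v _; exact: endo_comp.
Qed.

(** By sl(2) theory the root vectors of -T kill f too. The roots whose root vectors kill f form
    a closed set, so it contains all the roots, and g kills f. *)
Lemma centralizer_weight0 f : f \in centralizer -> f \in gwt (endo M) (0 : dualv h) ->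
  exists c : F, f = c *: \1%VF.
Proof.
move=> /centralizerP fc f0; apply: (schur simpleM) => x.
pose S : set (dualv h) := [set a | root_system h a /\
  forall y, y \in grs a -> lmod_action (endo M) y f = 0].
have hullS : closed_hull (T `|` opp_roots T) `<=` S.
  move=> a; apply; split; last first.
    move=> b [Tb|[c Tc <-]]; first by split=> [|y]; [exact: Troot | exact: fc].
    have [c0 gc] := (root_systemP hh hg c).1 (Troot Tc); split=> [|y yc].
      by apply/(root_systemP hh hg); rewrite oppr_eq0 c0 grs_opp.
    have [->|y0] := eqVneq y 0; first by rewrite linear0 lfunE.
    have [e ec cz] := sl2_triple hh hg c0 yc y0.
    have [zh ze zy] := sl2_triple_brackets hh hg ec yc cz.
    have y_nil v : gen_eigen (lmod_action (endo M) y) 0 v.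
      by apply: (root_vector_nilpotent hh _ yc); rewrite oppr_eq0.
    have [|-> //] := @primitive_weight0 _ _ (endo M) e y _ erefl ze zy y_nil f (fc c e Tc ec).
    by have := gwt_ev zh f0; rewrite /ev lfunE.
  split=> [b [] //|b c [rb Sb] [rc Sc] rbc]; split=> // w wbc.
  have [[b0 gb] [c0 gc]] := ((root_systemP hh hg b).1 rb, (root_systemP hh hg c).1 rc).
  have [bc0 _] := (root_systemP hh hg _).1 rbc.
  have [e [u [eb uc ->]]] := bracket_root_spaces hh hg b0 c0 bc0 gb gc wbc.
  by rewrite lmod_action_bracket (Sb e) // (Sc u) // !linear0 addr0.
have [X XP] : exists X : {vspace g}, forall y, y \in X <-> lmod_action (endo M) y f = 0.
  apply: lin_closed_vspace; split=> [|k u v u0 v0]; first by rewrite linear0 lfunE.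
  by have /= -> := lmod_action_linl (V := endo M) f k u v; rewrite u0 v0 scaler0 addr0.
apply/XP; rewrite (root_generation hh hg (X := X)) ?memvf //.
  by move=> u v /XP u0 /XP v0; apply/XP; rewrite lmod_action_bracket u0 v0 !linear0 addr0.
move=> a ra; rewrite (root_space_eq hh hg); apply/subvP => y ya; apply/XP.
by have [_] := hullS _ (Tgen ra); apply.
Qed.

(** The action of x on endomorphisms is a commutator, which has trace 0, so it multiplies
    traces by 0 although f is a generalized eigenvector for a(x) != 0. *)
Lemma lftrace_weight a f : a != 0 -> f \in gwt (endo M) a -> lftrace f = 0.
Proof.
move=> a0 fa; have [x xh ax] := ev_neq0 a0.
have [n fn] := gwt_ev xh fa; pose D := subscalar (lmod_action (endo M) x) (ev a x).
have trD k : lftrace (D k) = - ev a x * lftrace k.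
  have -> : D k = ((lmod_action M x \o (k : 'End(M))) - ((k : 'End(M)) \o lmod_action M x)
                  - ev a x *: (k : 'End(M)))%VF by rewrite /D subscalarE endoE.
  by rewrite !lftraceB lftraceZ lftraceC subrr sub0r mulNr.
have : lftrace (iter n D f) = (- ev a x) ^+ n * lftrace f.
  elim: n {fn} => [|n IHn]; first by rewrite mul1r.
  by rewrite iterS trD IHn mulrA exprS.
rewrite fn -[lftrace 0]/(lftrace (0 : 'End(M))) -(scale0r 0) lftraceZ mul0r => /esym/eqP.
by rewrite mulf_eq0 expf_eq0 oppr_eq0 (negPf ax) andbF => /eqP.
Qed.

(** A nonzero scalar f f' would make f' invertible, but f' is nilpotent. *)
Lemma centralizer_comp_opp a f f' : a != 0 -> f \in centralizer -> f' \in centralizer ->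
  f \in gwt (endo M) a -> f' \in gwt (endo M) (- a) -> (f \o f')%VF = 0.
Proof.
move=> a0 fc fc' fa fa'.
have [|c ffc] := centralizer_weight0 (centralizer_comp fc fc').
  by rewrite -(subrr a); exact: gwt_comp.
have [c0|c0] := eqVneq c 0; first by rewrite ffc c0 scale0r.
have Na0 : - a != 0 by rewrite oppr_eq0.
have [n n0] := gwt_shift_eq0 hnil (endo M) 0 Na0.
have inj v : f' v = 0 -> v = 0.
  move=> v0; have /lfunP/(_ v) := ffc; rewrite comp_lfunE v0 linear0 scale_lfunE id_lfunE.
  by move=> /esym/eqP; rewrite scaler_eq0 (negPf c0) => /eqP.
have : iter n (comp_lfun f') \1%VF \in gwt (endo M) (0 + (- a) *+ n).
  elim: n {n0} => [|n IHn].
    by apply/gwtP => x; rewrite addr0 lfunE; apply: gen_eigen_eigen; rewrite endo1 scale0r.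
  by rewrite iterS mulrSr addrA addrC; exact: gwt_comp.
rewrite n0 memv0 => /eqP it0; have [M0 _] := simpleM; case: M0.
apply/eqP; rewrite -subv0; apply/subvP => v _; rewrite memv0; apply/eqP.
have /lfunP/(_ v) := it0; rewrite lfunE; elim: n {n0 it0} => [|n IHn].
  by rewrite /= id_lfunE.
by rewrite iterS comp_lfunE => /inj.
Qed.

Lemma centralizer_trace0 a f f' : a != 0 -> f \in centralizer -> f' \in centralizer ->
  f \in gwt (endo M) a -> lftrace (f \o f')%VF = 0.
Proof.
move=> a0 fc fc' fa.
have [L LE] : exists L : 'Hom(endo M, F^o), forall k : endo M, L k = lftrace (f \o k)%VF.
  apply: (@linear_lfun _ (endo M) F^o) => k u v.
  by rewrite comp_lfunDr -comp_lfunZr lftraceD lftraceZ.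
suff : f' \in lker L by rewrite memv_ker LE => /eqP.
suff /subvP : (centralizer <= lker L)%VS by apply.
apply: (gwt_span hnil (V := endo M)).
  exact: centralizer_stable.
move=> b {}f' {}fc' fb; rewrite memv_ker LE; apply/eqP.
have [ab|ab] := eqVneq (a + b) 0; last by apply: lftrace_weight ab _; exact: gwt_comp.
have bE : b = - a by apply/eqP; rewrite -addr_eq0 addrC ab.
by rewrite (centralizer_comp_opp a0) -?bE // -(scale0r 0) lftraceZ mul0r.
Qed.

(** Let c be the scalar that is the component of f of weight 0. By centralizer_trace0,
    tr (f f') = c tr f' for f' in the centralizer; take f' = 1 and f' = f. *)
Lemma centralizer_idempotent f : f \in centralizer -> (f \o f)%VF = f -> f = 0 \/ f = \1%VF.
Proof.
move=> fc ff; pose p a : 'End(M) := wproj hnil (endo M) a f.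
have pc a : p a \in centralizer by exact: (wproj_stable hnil _ centralizer_stable fc).
have pa a : p a \in gwt (endo M) a by exact: (wproj_mem hnil (V := endo M)).
have [c p0] := centralizer_weight0 (pc 0) (pa 0).
have tr f' : f' \in centralizer -> lftrace (f \o f')%VF = c * lftrace f'.
  move=> fc'.
  have [L LE] : exists L : 'Hom(endo M, F^o), forall k : endo M,
      L k = lftrace ((k : 'End(M)) \o f')%VF.
    apply: (@linear_lfun _ (endo M) F^o) => k u v.
    by rewrite comp_lfunDl -comp_lfunZl lftraceD lftraceZ.
  rewrite -LE (wproj0_eq (hnil := hnil)) => [|a a0]; rewrite LE.
    by rewrite -/(p 0) p0 -comp_lfunZl comp_lfun1l lftraceZ.
  exact: centralizer_trace0 a0 (pc a) fc' (pa a).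
have c1 : \1%VF \in centralizer by apply/centralizerP => a y _ _; exact: endo1.
have trf := tr _ c1; rewrite comp_lfun1r lftrace1 in trf.
have [M0 _] := simpleM.
have d0 : (\dim {:M})%:R != 0 :> F by rewrite pnatr_eq0 dimv_eq0; apply/eqP.
have := tr _ fc; rewrite ff => /eqP; rewrite -subr_eq0 -{1}[lftrace f]mul1r -mulrBl mulf_eq0.
case/orP => [c_1|tr0].
  right; apply/eqP; rewrite eq_sym -subr_eq0.
  have id1 : ((\1 - f) \o (\1 - f))%VF = (\1 - f)%VF.
    rewrite comp_lfunDl comp_lfunDr comp_lfun1r comp_lfun1l comp_lfunNl comp_lfunDr.
    by rewrite comp_lfun1r comp_lfunNr ff subrr oppr0 addr0.
  have [n nE <-] := lftrace_idempotent id1.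
  move: nE; rewrite lftraceB lftrace1 trf; move: c_1; rewrite subr_eq0 => /eqP <-.
  by rewrite mul1r subrr => /esym/eqP; rewrite pnatr_eq0.
left; apply/eqP; have [n nE <-] := lftrace_idempotent ff.
by move: tr0; rewrite nE pnatr_eq0.
Qed.

(** The projection onto A along B commutes with s. *)
Lemma generating_indecomposable (s : {vspace g}) :
  (forall a, T a -> (root_space a <= s)%VS) -> indecomposable s M.
Proof.
move=> Ts A B sA sB AB1 AB0; pose P := daddv_pi A B.
have BA0 : (B :&: A)%VS = 0%VS by rewrite capvC.
have PA u : u \in A -> P u = u by exact: daddv_pi_id.
have PB v : v \in B -> P v = 0.
  move=> vB; have := daddv_pi_add AB0 (subvP (addvSr A B) v vB).
  by rewrite (daddv_pi_id BA0 vB) => Pv; apply: (addIr v); rewrite add0r.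
have Pdecomp w : exists2 u, u \in A & exists2 v, v \in B & w = u + v.
  by apply/memv_addP; rewrite AB1 memvf.
have Pc : P \in centralizer.
  apply/centralizerP => a y Ta ya; apply/endo_eq0P => w.
  have ys : y \in s by apply: (subvP (Ts a Ta)); rewrite (root_space_eq hh hg).
  have [u uA [v vB ->]] := Pdecomp w; rewrite !linearD /= (PA u) // (PB v) //.
  by rewrite (PA _ (sA _ _ ys uA)) (PB _ (sB _ _ ys vB)) linear0.
have PP : (P \o P)%VF = P by apply/lfunP => w; rewrite comp_lfunE daddv_pi_proj.
have [P0|P1] := centralizer_idempotent Pc PP; [left|right]; apply/eqP; rewrite -subv0;
  apply/subvP => w wU; rewrite memv0.
  by rewrite -(PA w wU) P0 lfunE.
by have := PB w wU; rewrite P1 id_lfunE => ->.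
Qed.

End Sufficiency.

(** * Necessity *)

Section IdealModule.
Variables (F : fieldType) (g : lieAlgType F) (I : {vspace g}).
Hypothesis idI : lie_ideal I.

Lemma ideal_action_exists : exists A : 'Hom(g, 'End(subvs_of I)), forall x u,
  vsval (A x u) = bracket x (vsval u).
Proof.
have /choice[A AE] x : exists Ax : 'End(subvs_of I), forall u,
    Ax u = vsproj I (bracket x (vsval u)).
  apply: linear_lfun => k u v.
  by rewrite (linearP vsval) (linearP (bracket x)) (linearP (vsproj I)).
have [|B BE] := @linear_lfun _ g 'End(subvs_of I) A.
  move=> k x y; apply/lfunP => u; rewrite add_lfunE scale_lfunE !AE.
  by rewrite bracketDl bracketZl (linearP (vsproj I)).
by exists B => x u; rewrite BE AE vsprojK // idI ?subvsP.
Qed.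

Definition ideal_action := projT1 (cid ideal_action_exists).

Lemma ideal_actionE x u : vsval (ideal_action x u) = bracket x (vsval u).
Proof. by rewrite /ideal_action; case: cid. Qed.

Lemma ideal_action_bracket x y u : ideal_action (bracket x y) u
  = ideal_action x (ideal_action y u) - ideal_action y (ideal_action x u).
Proof.
by apply: subvs_inj; rewrite linearB /= !ideal_actionE [bracket x (bracket y _)]bracketA addrK.
Qed.

Definition ideal_module : lieModule g := LieModule ideal_action_bracket.

Lemma ideal_moduleE x (u : subvs_of I) :
  vsval (lmod_action ideal_module x u : subvs_of I) = bracket x (vsval u).
Proof. exact: ideal_actionE. Qed.

Lemma ideal_module_simple : I != 0%VS ->
    (forall J : {vspace g}, lie_ideal J -> (J <= I)%VS -> J = 0%VS \/ J = I) ->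
  simple_module ideal_module.
Proof.
move=> I0 minI; split.
  move=> /vspaceP M0; case/negP: I0; rewrite -subv0; apply/subvP => x xI.
  have := M0 (Subvs xI); rewrite memvf memv0 => /esym/eqP/(congr1 vsval) /= ->.
  exact: mem0v.
move=> U sU; pose i : 'Hom(subvs_of I, g) := linfun vsval.
have iE u : i u = vsval u by rewrite lfunE.
have [||J0|JI] := minI (i @: (U : {vspace subvs_of I}))%VS.
- move=> x _ /memv_imgP[u uU ->].
  by rewrite iE -ideal_moduleE -iE memv_img // sU ?memvf.
- by apply/subvP => _ /memv_imgP[u uU ->]; rewrite iE subvsP.
- left; apply/eqP; rewrite -subv0; apply/subvP => u uU.
  have : i u \in 0%VS by rewrite -J0 memv_img.
  by rewrite !memv0 iE => /eqP u0; apply/eqP/subvs_inj; rewrite u0.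
- right; apply/vspaceP => u; rewrite memvf.
  have : vsval u \in (i @: (U : {vspace subvs_of I}))%VS by rewrite JI subvsP.
  by move=> /memv_imgP[u' u'U]; rewrite iE => /subvs_inj ->.
Qed.

End IdealModule.

Section Necessity.
Variable (C : numClosedFieldType).
Let F : fieldType := C.
Variables (g : lieAlgType F) (h : {vspace g}).
Hypotheses (hh : cartan_subalg h) (hg : lie_semisimple g).
Implicit Types (a b c : dualv h) (x y z u v : g) (I J U : {vspace g}).

(** Take an ideal I of least dimension containing the root space of a, and an ideal J inside
    I that does not contain it. Then J has no root vector for a nor, by sl(2) theory, for -a,
    so it is orthogonal to the root space of a. By minimality I lies in the orthogonal of J,
    so J is isotropic for the Killing form, and J = 0. *)
Lemma minimal_ideal a : root_system h a -> exists I, [/\ lie_ideal I, (grs a <= I)%VS &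
  forall J, lie_ideal J -> (J <= I)%VS -> J = 0%VS \/ J = I].
Proof.
move=> /(root_systemP hh hg)[a0 ga].
have [|I [idI aI] minI] := @vspace_min _ _ (fun I => lie_ideal I /\ (grs a <= I)%VS) {:g}%VS.
  by split=> [x y _|]; [exact: memvf | exact: subvf].
exists I; split=> // J idJ JI.
have [aJ|aJ] := boolP (grs a <= J)%VS.
  by right; apply/eqP; rewrite eqEdim JI minI.
left; have Ja x : x \in J -> x \in grs a -> x = 0.
  move=> xJ xa; apply/eqP; apply: contraT => x0; case/negP: aJ.
  apply/subvP => y ya; have [k ->] := root_space_line hh hg a0 xa x0 ya.
  exact: memvZ.
have JNa y : y \in J -> y \in grs (- a) -> y = 0.
  move=> yJ ya; apply/eqP; apply: contraT => y0.
  have [e ea az] := sl2_triple hh hg a0 ya y0.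
  have [zh ze _] := sl2_triple_brackets hh hg ea ya az.
  have zJ : bracket e y \in J by exact: idJ.
  have e2 : 2%:R *: e = 0.
    by apply: Ja; [rewrite -ze bracketC memvN idJ | exact: memvZ].
  have {e2} e0 : e = 0 by apply/eqP; move/eqP: e2; rewrite scaler_eq0 pnatr_eq0.
  by move/eqP: az; rewrite e0 bracketC linear0 oppr0 /ev !linear0 eq_sym pnatr_eq0.
have aK : (grs a <= killing_orthogonal J)%VS.
  apply/subvP => x xa; apply/killing_orthogonalP => y yJ.
  suff : y \in killing_orthogonal <[x]>.
    by rewrite killingC => /killing_orthogonalP; apply; exact: memv_line.
  move: y yJ; apply/subvP/(grs_span hh) => [u v _|b y yJ yb]; first exact: idJ.
  apply/killing_orthogonalP => _ /vlineP[k ->]; rewrite killingZr killingC.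
  have [ab|ab] := eqVneq (a + b) 0; last by rewrite (killing_grs hh xa yb ab) mulr0.
  have bE : b = - a by apply/eqP; rewrite -addr_eq0 addrC ab.
  by rewrite (JNa y) -?bE // killing0r mulr0.
have idK := killing_orthogonal_ideal idJ.
have IK : (I <= killing_orthogonal J)%VS.
  have /minI dI : lie_ideal (I :&: killing_orthogonal J)%VS /\
      (grs a <= I :&: killing_orthogonal J)%VS.
    split; last by rewrite subv_cap aI.
    by move=> x y /memv_capP[yI yK]; rewrite memv_cap idI ?idK.
  by have /eqP <- : (I :&: killing_orthogonal J)%VS == I; rewrite ?capvSr // eqEdim capvSl dI.
apply: (killing_isotropic_ideal hh hg idJ) => x xJ.
by have /killing_orthogonalP := subvP IK _ (subvP JI _ xJ); apply.
Qed.

(** Let p be the projection of g onto the span of h and of the root spaces of S along the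
    other root spaces. As S is closed and symmetric, p commutes with ad x for x in h and
    for x a root vector of S. On the simple ideal containing the root space of a, the
    image and the kernel of p are nonzero: they contain the coroot of a and its root
    space. *)
Lemma decomposable_simple_module (S : set (dualv h)) a (s : {vspace g}) :
    closed_roots S -> (forall b, S b -> S (- b)) -> root_system h a -> ~ S a ->
    (forall X : {vspace g}, (h <= X)%VS -> (forall b, S b -> (root_space b <= X)%VS) ->
       (s <= X)%VS) ->
  exists2 M : lieModule g, simple_module M & ~ indecomposable s M.
Proof.
move=> [Sr Scl] SN ra Sa sS; have [I [idI aI minI]] := minimal_ideal ra.
have [a0 ga] := (root_systemP hh hg a).1 ra.
have I0 : I != 0%VS by apply: contraNneq ga => I0; rewrite -subv0 -I0.
exists (ideal_module idI); first exact: ideal_module_simple.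
pose k b : F := `[< b = 0 \/ S b >]%:R.
have k1 b : b = 0 \/ S b -> k b = 1 by move=> Sb; rewrite /k asboolT.
have k01 b : k b * k b = k b by rewrite -natrM mulnb andbb.
pose p := weight_scaling hh k.
have pp v : p (p v) = p v.
  rewrite -comp_lfunE; move: v; apply/lfunP/(eq_on_grs hh) => b v vb.
  by rewrite comp_lfunE !(weight_scalingE _ _ vb) linearZ /= (weight_scalingE _ _ vb) scalerA k01.
have pI v : v \in I -> p v \in I.
  move=> vI; rewrite sum_lfunE; apply: memv_suml => b _; rewrite scale_lfunE memvZ //.
  by apply: gproj_stable => // x u _; exact: idI.
pose X := pred_vspace (fun x => forall v, p (bracket x v) = bracket x (p v)).
have XP x : reflect (forall v, p (bracket x v) = bracket x (p v)) (x \in X).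
  have br0 w : bracket 0 w = 0 by rewrite bracketC linear0 oppr0.
  apply: pred_vspaceP; split=> [v|c x1 x2 x1p x2p v]; first by rewrite !br0 linear0.
  by rewrite !bracketDl !bracketZl (linearP p) /= x1p x2p.
have rootk b : b != 0 -> grs b != 0%VS -> root_system h b.
  by move=> b0 gb; apply/(root_systemP hh hg).
have Xgrs b : b = 0 \/ S b -> (grs b <= X)%VS.
  move=> Sb; apply/subvP => x xb; apply/XP => v.
  have comm : (p \o ad x = ad x \o p)%VF.
    apply: (@weight_scaling_comm C g h hh k (ad x) b) => [c gc gcb|c u uc]; last first.
      by rewrite adE addrC bracket_grs.
    case: Sb => [->|Sb]; first by rewrite addr0.
    congr (nat_of_bool _)%:R; apply/asboolP/asboolP => -[cE|Sc].
    - have -> : c = - b by apply/eqP; rewrite -addr_eq0 cE.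
      by right; apply: SN.
    - have [->|c0] := eqVneq c 0; first by left.
      by right; rewrite -(addrK b c); apply: Scl (SN _ Sb) _ => //; rewrite addrK; apply: rootk.
    - by right; rewrite cE add0r.
    - have [->|cb0] := eqVneq (c + b) 0; first by left.
      by right; apply: Scl => //; apply: rootk.
  by have /lfunP/(_ v) := comm; rewrite !comp_lfunE !adE.
have /subvP sX : (s <= X)%VS.
  apply: sS => [|b Sb]; first by rewrite -(grs0 hh) Xgrs //; left.
  by rewrite (root_space_eq hh hg) Xgrs //; right.
pose i : 'Hom(subvs_of I, g) := linfun vsval.
have iE (u : subvs_of I) : i u = vsval u by rewrite lfunE.
pose A : {vspace subvs_of I} := lker ((p \o i) - i)%VF.
pose B : {vspace subvs_of I} := lker (p \o i)%VF.
have AP (u : subvs_of I) : (u \in A) = (p (vsval u) == vsval u).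
  by rewrite memv_ker add_lfunE opp_lfunE comp_lfunE iE subr_eq0.
have BP (u : subvs_of I) : (u \in B) = (p (vsval u) == 0) by rewrite memv_ker comp_lfunE iE.
move=> /(_ A B) [].
- move=> x u xs; rewrite !AP ideal_moduleE => /eqP pu.
  by have /XP -> := sX x xs; rewrite pu.
- move=> x u xs; rewrite !BP ideal_moduleE => /eqP pu.
  by have /XP -> := sX x xs; rewrite pu linear0.
- apply/vspaceP => u; rewrite memvf; apply/memv_addP.
  have puI := pI _ (subvsP u); exists (Subvs puI); first by rewrite AP /= pp.
  exists (u - Subvs puI); last by rewrite addrC subrK.
  by rewrite BP (_ : vsval _ = vsval u - p (vsval u)) // (linearB p) /= pp subrr.
- apply/eqP; rewrite -subv0; apply/subvP => u /memv_capP[]; rewrite AP BP memv0.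
  by move=> /eqP pu /eqP pu0; apply/eqP/subvs_inj; rewrite -pu pu0.
- have [f fa f0] : exists2 f, f \in grs (- a) & f != 0.
    by exists (vpick (grs (- a))); rewrite ?memv_pick // vpick0 grs_opp.
  have [e ea az] := sl2_triple hh hg a0 fa f0.
  have eI : e \in I by exact: subvP aI _ ea.
  have zI : bracket e f \in I by rewrite bracketC memvN idI.
  have z0 : bracket e f \in grs (0 : dualv h) by rewrite (grs0 hh) (opposite_bracket hh ea fa).
  move=> A0; have : Subvs zI \in A by rewrite AP /= (weight_scalingE _ _ z0) k1 ?scale1r //; left.
  rewrite A0 memv0 => /eqP/(congr1 vsval) /= ez; move/eqP: az.
  by rewrite ez /ev !linear0 eq_sym pnatr_eq0.
- have vI : vpick (grs a) \in I by apply: (subvP aI); exact: memv_pick.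
  move=> B0; have : Subvs vI \in B.
    rewrite BP /= (weight_scalingE _ _ (memv_pick _)) /k asboolF ?scale0r // => -[a_0|//].
    by rewrite a_0 eqxx in a0.
  rewrite B0 memv0 => /eqP/(congr1 vsval) /= /eqP.
  by rewrite vpick0 (negPf ga).
Qed.

(** The opposite of a closed set containing T and -T is another such set. *)
Lemma closed_hull_opp (T : set (dualv h)) b :
  closed_hull (T `|` opp_roots T) b -> closed_hull (T `|` opp_roots T) (- b).
Proof.
move=> hb U [[Ur Ucl] TU]; have := hb [set c | U (- c)]; apply; split.
  split=> [c /Ur/(root_systemP hh hg)[c0 gc]|c d Uc Ud rcd] /=.
    by apply/(root_systemP hh hg); rewrite -oppr_eq0 c0 -(opprK c) grs_opp.
  rewrite opprD; apply: Ucl => //; rewrite -opprD.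
  move: rcd => /(root_systemP hh hg)[cd0 gcd]; apply/(root_systemP hh hg).
  by rewrite oppr_eq0 cd0 grs_opp.
move=> c [Tc|[d Td <-]] /=; apply: TU; last by left; rewrite opprK.
by right; exists c.
Qed.

End Necessity.

Theorem corollary3p10 (R : realType) (g : lieAlgType R[i])
    (hg : lie_semisimple g) (h : {vspace g}) (hh : cartan_subalg h)
    (T : set (dualv h)) (hT : closed_roots T)
    (t : {vspace g}) (hth : (t <= h)%VS) (ht : lie_subalg t)
    (htT : forall a : dualv h, symm_part T a ->
       (lie_prod (root_space a) (root_space (- a)) <= t)%VS) :
  wide (regular_subalg T t) <-> closed_hull (T `|` opp_roots T) = root_system h.
Proof.
have [Troot _] := hT; split=> [wideT|TE M simpleM]; last first.
  apply: (generating_indecomposable hh hg Troot _ simpleM) => [|a Ta].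
    by rewrite TE.
  exact: sub_root_regular.
have TNroot : T `|` opp_roots T `<=` root_system h.
  move=> a [/Troot //|[b /Troot rb <-]]; have [b0 gb] := (root_systemP hh hg b).1 rb.
  by apply/(root_systemP hh hg); rewrite oppr_eq0 b0 (grs_opp hh hg).
have hull := closed_roots_hull TNroot.
apply/seteqP; split=> [a /hull.1 //|a ra]; apply: contrapT => aN.
have [|M simpleM] := decomposable_simple_module hh hg (s := regular_subalg T t) hull
    (@closed_hull_opp _ _ _ hh hg T) ra aN; last by case; apply: wideT.
move=> X hX SX; apply/(regular_subP _ _ Troot); split; first exact: subv_trans hX.
by move=> b Tb; apply: SX => U [_ TU]; apply: TU; left.
Qed.
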